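(* For an integer $m$, a Goldbach partition of $m$ is an unordered representation $m=p+q$ with $p,q$ odd primes (so the pair $\{p,q\}$, with $p\le q$, is counted once). For an integer $n>2$, let $\Sigma_{2n}$ be the set of all Goldbach partitions of all even integers in the interval $(4,2n]$, and equip $\Sigma_{2n}$ with the uniform probability measure $\mathbb{P}$ (each partition has probability $1/|\Sigma_{2n}|$). Let $G_n$ be the random variable defined by: $2G_n\in(4,2n]$ is the even integer partitioned by the randomly selected element of $\Sigma_{2n}$. Let $T=\max\{U_1,U_2\}$, where $U_1,U_2$ are independent random variables uniformly distributed on $(0,1)$, and let $\mu_T$ and $\sigma_T^2$ denote its mean and variance. Then, with expectation $\mathbb{E}$ and variance $\mathbb{V}ar$ taken with respect to $\mathbb{P}$, (i) $\displaystyle\lim_{n\to\infty}\frac{1}{n}\mathbb{E}(G_n)=\mu_T=\frac{2}{3}$; (ii) $\displaystyle\lim_{n\to\infty}\frac{1}{n^2}\mathbb{V}ar(G_n)=\sigma_T^2=\frac{1}{18}$.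
   Context: Equivalently, $\mathbb{P}(G_n=k)=Q_2(2k)/\sum_{2<j\le n}Q_2(2j)$ for integers $2<k\le n$, where $Q_2(2k)$ denotes the number of unordered representations of $2k$ as a sum of two odd primes. The random variable $T$ has cumulative distribution function $F(u)=0$ for $u\le 0$, $F(u)=u^2$ for $0<u<1$, $F(u)=1$ for $u\ge 1$. *)

(* Defs.v *)
From HB Require Import structures.
From mathcomp Require Import all_boot all_order all_algebra.
From mathcomp Require Import all_classical all_reals all_analysis.
Unset Printing Implicit Defensive.
Import Order.TTheory GRing.Theory Num.Theory.
Import numFieldNormedType.Exports.
Local Open Scope ring_scope.

(* A Goldbach partition is an unordered pair {p,q} of odd primes, encoded by
   the ordered pair (p,q) with p <= q.  [goldbach_space n] = Sigma_{2n}: all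
   Goldbach partitions of all even integers m with 4 < m <= 2n (no duplicates). *)
Definition odd_prime (p : nat) : bool := prime p && odd p.

Definition goldbach_space (n : nat) : seq (nat * nat) :=
  [seq pq <- [seq (p, q) | p <- iota 0 (2 * n).+1, q <- iota 0 (2 * n).+1]
     | [&& odd_prime pq.1, odd_prime pq.2, pq.1 <= pq.2,
           4 < pq.1 + pq.2 & pq.1 + pq.2 <= 2 * n]%N].

Definition Gn (pq : nat * nat) : nat := ((pq.1 + pq.2) %/ 2)%N.

Definition expect_G (R : realType) (n : nat) : R :=
  (\sum_(pq <- goldbach_space n) (Gn pq)%:R) / (size (goldbach_space n))%:R.

Definition var_G (R : realType) (n : nat) : R :=
  (\sum_(pq <- goldbach_space n) ((Gn pq)%:R - expect_G R n) ^+ 2)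
    / (size (goldbach_space n))%:R.

(* (U1,U2) independent uniform on (0,1): joint law = product of uniform laws
   on R x R; T = max(U1,U2). *)
Definition unif01 (R : realType) := @uniform_prob R 0 1 ltr01.

Definition joint_U (R : realType) :=
  (unif01 R \x unif01 R)%E.

Definition mu_T (R : realType) : R :=
  fine (\int[joint_U R]_(u in setT) (Num.max u.1 u.2)%:E)%E.

Definition sigma2_T (R : realType) : R :=
  fine (\int[joint_U R]_(u in setT) ((Num.max u.1 u.2 - mu_T R) ^+ 2)%:E)%E.

(* Main.v *)
(* Everything rests on the prime number theorem, proved by Selberg's method in
   terms of [R(N) = psi(N) - N] at integers [N].  The Tatuzawa-Iseki identity
   gives Selberg's formula, and iterating it yields
     [|R(N)| ln^2 N <= 2 N sum_(m < N) T(m) (ln (m+1) - ln m) + O(N ln N)]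
   with [T(m) = sum_(j <= m) |R(j)| / (j (j+1))].  If [a = limsup |R(N)| / N]
   were positive, the boundedness of [sum_(j <= m) R(j) / (j (j+1))] would force
   every window [(y, K y]] to contain an interval of fixed logarithmic length on
   which [|R(m)| <= a m / 2]; hence [T(m) <= b ln m + O(1)] with [b < a], and
   the inequality above contradicts the choice of [a].

   Weighting an ordered pair of odd primes [(p, q)] by [ln p ln q], the pairs with
   [p + q <= N] have total weight [~ N^2 / 2], and Abel summation gives the
   moments of [p + q].  The weight is [~ ln^2 N] outside a negligible set of
   pairs, so the uniform measure has the same normalized moments [1/2, 1/3, 1/4];
   passing to unordered pairs only costs the diagonal.  The limits are then
   [(1/3)/(1/2)] and [(1/4)/(1/2) - (2/3)^2], the mean and variance of the
   maximum of two uniform variables. *)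

(* Only sums of the Goldbach counting function over all even integers up to [N] enter, never its
   individual values. Such a sum is a convolution of the prime counting function with itself, so the
   prime number theorem determines it: about a fraction [t^2] of the pairs with [p + q <= N] satisfy
   [p + q <= t N], and [t^2] is the distribution function of [T].

   In the contradiction argument the factor 2 of the inequality is harmless, because [sum_(m < N) ln
   m (ln (m+1) - ln m) <= ln^2 N / 2]: a bound of slope [b] on [T(m)] returns
   [|R(N)| <= (b + o(1)) N]. Bounding every term of [T(m)] by the limsup only gives slope [a]; the
   intervals of small remainder supply the strict gain. They exist because [R] falls by at most 1
   and rises by at most [ln n] in one step, so it cannot change sign without passing through small
   values, and because [psi] grows at a bounded rate on short intervals, so that a small value
   persists. *)
Require Import Defs.
From HB Require Import structures.
From mathcomp Require Import all_boot all_order all_algebra.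
From mathcomp Require Import all_classical all_reals all_analysis.
From mathcomp Require Import measurable_realfun ring lra zify.
Import Order.TTheory GRing.Theory Num.Theory.
Import numFieldNormedType.Exports.
Set Implicit Arguments.
Unset Strict Implicit.
Unset Printing Implicit Defensive.
Local Open Scope ring_scope.
Local Open Scope classical_set_scope.

(* [lra] reads syntactically different but convertible inverses as distinct
   atoms; abstracting them up to conversion identifies them. *)
Ltac open_nat n :=
  lazymatch n with S ?m => open_nat m | O => fail | _ => idtac end.
Ltac ilra :=
  repeat match goal with
  | |- context [GRing.inv (GRing.natmul ?a ?n)] =>
      open_nat n; move: (GRing.inv (GRing.natmul a n)) => ?
  end; intros; lra.

(** * Moebius and von Mangoldt functions *)

Definition moebius {R : realType} (n : nat) : R :=
  if all (fun p => logn p n == 1)%N (primes n) then (-1) ^+ size (primes n)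
  else 0.

Definition mangoldt {R : realType} (n : nat) : R :=
  if size (primes n) == 1%N then ln (pdiv n)%:R else 0.

Lemma sum_multiples {V : nmodType} (d N : nat) (G : nat -> V) : (0 < d)%N ->
  \sum_(1 <= k < N.+1 | (d %| k)%N) G k
    = \sum_(1 <= m < (N %/ d).+1) G (d * m)%N.
Proof.
move=> d0; elim: N => [|N IH]; first by rewrite div0n !big_geq.
rewrite big_mkcond big_nat_recr//= -big_mkcond IH divnS//.
case: ifP => [dN|_]; last by rewrite addr0.
rewrite add1n [RHS]big_nat_recr//=; congr (_ + G _).
by rewrite -{1}(divnK dN) divnS// dN add1n mulnC.
Qed.

Lemma sum_divisors_widen {V : nmodType} (k N : nat) (P : pred nat)
    (G : nat -> V) : (0 < k <= N)%N ->
  \sum_(1 <= d < N.+1 | (d %| k)%N && P d) G d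
    = \sum_(1 <= d < k.+1 | (d %| k)%N && P d) G d.
Proof.
move=> /andP[k0 kN]; rewrite [RHS](big_nat_widen 1 k.+1 N.+1)//.
rewrite [LHS]big_nat_cond [RHS]big_nat_cond; apply: eq_bigl => d.
case dk: (d %| k)%N => /=; last by rewrite !andbF.
by rewrite [(d < k.+1)%N]ltnS (dvdn_leq k0 dk) !andbT.
Qed.

(** Both sides run over the pairs with [d * m <= N]; the right one groups them by their product
    [k]. *)
Lemma sum_hyperbola {V : nmodType} (N : nat) (F : nat -> nat -> V) :
  \sum_(1 <= d < N.+1) \sum_(1 <= m < (N %/ d).+1) F d m
  = \sum_(1 <= k < N.+1) \sum_(1 <= d < k.+1 | (d %| k)%N) F d (k %/ d)%N.
Proof.
transitivity (\sum_(1 <= k < N.+1) \sum_(1 <= d < N.+1 | (d %| k)%N)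
    F d (k %/ d)%N); last first.
  apply: eq_big_nat => k /andP[k0]; rewrite ltnS => kN.
  have := @sum_divisors_widen V k N predT (fun d => F d (k %/ d)%N).
  by rewrite k0 kN => /(_ isT); under eq_bigl do rewrite andbT;
    under [X in _ = X -> _]eq_bigl do rewrite andbT.
rewrite (exchange_big_dep_nat predT)//=.
apply: eq_big_nat => d /andP[d0 _].
rewrite (sum_multiples N (fun k => F d (k %/ d)%N) d0).
by apply: eq_bigr => m _; rewrite mulKn.
Qed.

Section ArithmeticFunctions.
Variable R : realType.
Local Notation mu := (@moebius R).
Local Notation Lam := (@mangoldt R).

Lemma moebius_le1 n : `|mu n| <= 1.
Proof.
rewrite /moebius; case: ifP => _; last by rewrite normr0 ler01.
by rewrite normrX normrN1 expr1n.
Qed.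

Lemma moebius1 : mu 1 = 1.
Proof. by rewrite /moebius. Qed.

Lemma primes_mul_coprime p m : prime p -> ~~ (p %| m)%N ->
  perm_eq (primes (p * m)) (p :: primes m).
Proof.
move=> pp pm; have m0 : (0 < m)%N by case: m pm; rewrite ?dvdn0.
apply: uniq_perm; rewrite ?primes_uniq//=.
  by rewrite primes_uniq andbT mem_primes pp m0.
by move=> q; rewrite primesM ?(prime_gt0 pp)// primes_prime// !inE.
Qed.

Lemma moebiusM p m : prime p -> ~~ (p %| m)%N -> mu (p * m) = - mu m.
Proof.
move=> pp pm; have m0 : (0 < m)%N by case: m pm; rewrite ?dvdn0.
rewrite /moebius (perm_all _ (primes_mul_coprime pp pm)).
rewrite (perm_size (primes_mul_coprime pp pm)) /=.
have lp0 : logn p m = 0%N.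
  by apply/eqP; rewrite -leqn0 leqNgt logn_gt0 mem_primes pp m0.
rewrite lognM ?(prime_gt0 pp)// logn_prime// eqxx lp0 addn0 eqxx /=.
rewrite (_ : all _ _ = all (fun p => logn p m == 1)%N (primes m)).
  by case: ifP; rewrite ?oppr0// exprS mulN1r.
apply: eq_in_all => q qm; rewrite lognM ?(prime_gt0 pp)// logn_prime//.
case: (eqVneq q p) => [qp|//]; move: qm pm.
by rewrite -qp mem_primes => /and3P[_ _ ->].
Qed.

Lemma moebius_sq p m : prime p -> (p %| m)%N -> (0 < m)%N -> mu (p * m) = 0.
Proof.
move=> pp pm m0; rewrite /moebius; case: ifP => // /allP /(_ p).
rewrite primesM ?(prime_gt0 pp)// primes_prime// inE eqxx => /(_ isT).
rewrite lognM ?(prime_gt0 pp)// logn_prime// eqxx.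
have : (0 < logn p m)%N by rewrite logn_gt0 mem_primes pp m0.
by case: (logn p m).
Qed.

(* Pairing [d] with [p * d] for a fixed prime [p | k] cancels everything. *)
Lemma sum_moebius N k : (0 < k <= N)%N ->
  \sum_(1 <= d < N.+1 | (d %| k)%N) mu d = (k == 1%N)%:R.
Proof.
move=> /andP[k0 kN]; case: (ltngtP k 1) => [||->]; first by case: k k0 kN.
  move=> k1; set p := pdiv k; have pp : prime p by apply: pdiv_prime.
  have pk : (p %| k)%N by apply: pdiv_dvd.
  rewrite (bigID (fun d => p %| d)%N) /=.
  under eq_bigl do rewrite andbC.
  rewrite big_mkcondr (sum_multiples N (fun d => if (d %| k)%N then mu d else 0))
    ?(prime_gt0 pp)//.
  rewrite [X in _ + X](_ : _ = - \sum_(1 <= m < (N %/ p).+1)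
    (if (p * m %| k)%N then mu (p * m)%N else 0)); first by rewrite subrr.
  rewrite -sumrN [RHS](big_nat_widen 1 _ N.+1) ?ltnS ?leq_div//.
  rewrite big_mkcond [RHS]big_mkcond; apply: eq_big_nat => d /andP[d0 dN].
  rewrite andTb; case pd: (p %| d)%N => /=.
    by rewrite andbF moebius_sq// if_same oppr0 if_same.
  rewrite andbT; have cpd : coprime p d by rewrite prime_coprime// pd.
  rewrite Gauss_dvd// pk /=; case dk: (d %| k)%N; last by rewrite oppr0 if_same.
  rewrite moebiusM ?pd// opprK ltnS leq_divRL ?(prime_gt0 pp)//.
  rewrite (leq_trans _ kN)// mulnC dvdn_leq// Gauss_dvd// pk.
  by rewrite dk.
rewrite (eq_bigl (fun d => d == 1)%N) => [|d]; last by rewrite dvdn1.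
by rewrite big_nat1_eq (_ : (1 <= 1 < N.+1)%N = true) ?moebius1//; lia.
Qed.

Lemma prime_powerP d : size (primes d) == 1%N ->
  prime (pdiv d) /\ d = (pdiv d ^ logn (pdiv d) d)%N.
Proof.
case E: (primes d) => [//|p [|//]] _.
have : p \in primes d by rewrite E inE.
rewrite mem_primes => /and3P[pp d0 pd].
have d1 : (1 < d)%N by case: d d0 E {pd} => [//|[|//]].
have : pdiv d \in primes d by rewrite mem_primes pdiv_prime ?pdiv_dvd ?d0.
rewrite E inE => /eqP ->; split => //.
rewrite -p_part part_pnat_id//; apply/pnatP => // q qp qd.
have : q \in primes d by rewrite mem_primes qp d0 qd.
by rewrite E inE.
Qed.

Lemma mangoldt1 : Lam 1 = 0.
Proof. by rewrite /mangoldt. Qed.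

Lemma primes_pow p e : prime p -> (0 < e)%N -> primes (p ^ e) = [:: p].
Proof. by move=> pp e0; rewrite primesX// primes_prime. Qed.

Lemma mangoldt_pow p e : prime p -> (0 < e)%N -> Lam (p ^ e) = ln p%:R.
Proof.
move=> pp e0; rewrite /mangoldt primes_pow//= -(prednK e0) pdiv_pfactor//.
Qed.

Lemma mangoldt_prime p : prime p -> Lam p = ln p%:R.
Proof. by move=> pp; rewrite -(@mangoldt_pow p 1). Qed.

Lemma mangoldt_ge0 n : 0 <= Lam n.
Proof.
rewrite /mangoldt; case: ifP => // _; apply: ln_ge0.
by rewrite ler1n pdiv_gt0.
Qed.

Lemma mangoldt_le n : (0 < n)%N -> Lam n <= ln n%:R.
Proof.
move=> n0; rewrite /mangoldt; case: ifP => // _; last by rewrite ln_ge0// ler1n.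
by rewrite ler_ln ?posrE ?ltr0n ?pdiv_gt0// ler_nat pdiv_leq.
Qed.

Lemma lnMn m n : (0 < m)%N -> (0 < n)%N ->
  ln (m * n)%:R = ln m%:R + ln n%:R :> R.
Proof. by move=> m0 n0; rewrite natrM lnM// posrE ltr0n. Qed.

(** Induction on [k = p * m] with [p] the least prime divisor. The only prime power that divides [k]
    but not [m] is [q], the full power of [p] in [k], and it contributes the missing [ln p]. *)
Lemma sum_mangoldt N k : (0 < k <= N)%N ->
  \sum_(1 <= d < N.+1 | (d %| k)%N) Lam d = ln k%:R.
Proof.
elim/ltn_ind: k => k IH /andP[k0 kN]; have [k1|k1] := leqP k 1.
  rewrite (_ : k = 1)%N; last by case: k k0 k1 {IH kN} => [|[]].
  rewrite ln1 (eq_bigl (fun d => d == 1)%N) => [|d]; last by rewrite dvdn1.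
  by rewrite big_nat1_eq mangoldt1 if_same.
set p := pdiv k; have pp : prime p by apply: pdiv_prime.
have pk : (p %| k)%N by apply: pdiv_dvd.
set m := (k %/ p)%N; have km : k = (p * m)%N by rewrite mulnC divnK.
have m0 : (0 < m)%N by move: k0; rewrite km muln_gt0 => /andP[].
have mk : (m < k)%N by rewrite km -{1}(mul1n m) ltn_pmul2r// prime_gt1.
rewrite km lnMn ?(prime_gt0 pp)// -km (bigID (fun d => d %| m)%N) /= addrC.
congr (_ + _); last first.
  rewrite -(IH m mk); last by rewrite m0 (leq_trans (ltnW mk)).
  apply: eq_bigl => d; case dm: (d %| m)%N; rewrite ?andbF// andbT km.
  exact: dvdn_mull.
have lk : logn p k = (logn p m).+1.
  by rewrite km lognM ?(prime_gt0 pp)// logn_prime// eqxx.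
set q := (p ^ (logn p m).+1)%N.
have qk : (q %| k)%N by rewrite pfactor_dvdn// lk.
have qm : (q %| m)%N = false by rewrite pfactor_dvdn// ltnn.
have qi : q \in index_iota 1 N.+1.
  by rewrite mem_index_iota expn_gt0 prime_gt0//= ltnS (leq_trans _ kN)// dvdn_leq.
rewrite big_mkcond (bigD1_seq q) ?iota_uniq//= qk qm mangoldt_pow//.
rewrite big1 ?addr0// => d dq; case: ifP => // /andP[dk dm]; rewrite /mangoldt.
case: ifP => // /prime_powerP; set r := pdiv d => -[rp dE].
have d0 : (0 < d)%N by rewrite dE expn_gt0 prime_gt0.
case: (eqVneq r p) => [rpE|rp']; last first.
  move: dm; rewrite -(@Gauss_dvdr d p m) -?km ?dk//.
  rewrite dE coprimeXl//; rewrite prime_coprime//.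
  by rewrite dvdn_prime2.
move: dk dm dq; rewrite dE rpE => dk dm /eqP[].
apply/eqP; rewrite /q eqn_exp2l ?prime_gt1// eqn_leq.
move: dk; rewrite pfactor_dvdn// lk => -> /=.
by rewrite ltnNge -pfactor_dvdn.
Qed.

(** Moebius inversion of [sum_mangoldt]: expand [ln (k / d)] over the divisors [e] of [k / d] and
    exchange the sums; the inner Moebius sum vanishes unless [e = k]. *)
Lemma moebius_ln N k : (0 < k <= N)%N ->
  \sum_(1 <= d < N.+1 | (d %| k)%N) mu d * (ln k%:R - ln d%:R) = Lam k.
Proof.
move=> /andP[k0 kN].
transitivity (\sum_(1 <= d < N.+1 | (d %| k)%N)
   \sum_(1 <= e < N.+1 | (e * d %| k)%N) mu d * Lam e).
  rewrite big_nat_cond [RHS]big_nat_cond.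
  apply: eq_bigr => d /andP[/andP[d0 dN] dk]; rewrite -mulr_sumr; congr (_ * _).
  rewrite (eq_bigl (fun e => e %| k %/ d)%N) => [|e]; last by rewrite dvdn_divRL.
  rewrite sum_mangoldt; last by rewrite divn_gt0// dvdn_leq//= (leq_trans (leq_div _ _)).
  by rewrite -{1}(divnK dk) lnMn ?addrK// divn_gt0// dvdn_leq.
rewrite (exchange_big_dep_nat (fun e => e %| k)%N) /=; last first.
  by move=> d e _ _ _ /(dvdn_trans _); apply; rewrite dvdn_mulr.
transitivity (\sum_(1 <= e < N.+1 | (e %| k)%N) Lam e * (k %/ e == 1)%N%:R).
  rewrite big_nat_cond [RHS]big_nat_cond.
  apply: eq_bigr => e /andP[/andP[e0 eN] ek].
  rewrite -(@sum_moebius N); last first.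
    by rewrite divn_gt0// dvdn_leq//= (leq_trans (leq_div _ _)).
  rewrite mulr_sumr; apply: eq_big => [d|d _]; last by rewrite mulrC.
  rewrite dvdn_divRL// (mulnC e); case: (boolP (d * e %| k)%N); last by rewrite andbF.
  by move=> /(dvdn_trans _) ->//; rewrite dvdn_mulr.
rewrite big_mkcond (bigD1_seq k) ?iota_uniq//= ?mem_index_iota ?k0 ?ltnS//.
rewrite dvdnn divnn k0 eqxx mulr1 big1 ?addr0// => e ne; case: ifP => // ek.
case: eqP => [ke|]; last by rewrite mulr0.
by move: ne; rewrite -(divnK ek) ke mul1n eqxx.
Qed.

End ArithmeticFunctions.

(** * Chebyshev and Mertens estimates *)

Lemma sum_hyperbola_swap {V : nmodType} (N : nat) (F : nat -> nat -> V) :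
  \sum_(1 <= d < N.+1) \sum_(1 <= m < (N %/ d).+1) F d m
  = \sum_(1 <= m < N.+1) \sum_(1 <= d < (N %/ m).+1) F d m.
Proof.
transitivity (\sum_(1 <= d < N.+1) \sum_(1 <= m < N.+1 | (d * m <= N)%N) F d m).
  apply: eq_big_nat => d /andP[d0 _].
  rewrite (big_nat_widen 1 _ N.+1) ?ltnS ?leq_div//.
  by apply: eq_bigl => m; rewrite ltnS leq_divRL// mulnC.
rewrite (exchange_big_dep_nat predT)//=.
apply: eq_big_nat => m /andP[m0 _].
rewrite [RHS](big_nat_widen 1 _ N.+1) ?ltnS ?leq_div//.
by apply: eq_bigl => d; rewrite ltnS leq_divRL.
Qed.

Lemma bin_le_exp2 n m : ('C(n, m) <= 2 ^ n)%N.
Proof.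
elim: n m => [|n IH] [|m]; rewrite ?bin0 ?bin0n ?expn_gt0//.
by rewrite binS expnS mul2n -addnn leq_add.
Qed.

Definition chebyshev_psi {R : realType} (N : nat) : R := \sum_(1 <= k < N.+1) mangoldt k.

Definition harmonic_sum {R : realType} (N : nat) : R := \sum_(1 <= k < N.+1) k%:R^-1.

Section Chebyshev.
Variable R : realType.
Local Notation Lam := (@mangoldt R).
Local Notation psi := (@chebyshev_psi R).
Local Notation harm := (@harmonic_sum R).
Local Notation lg n := (@ln R n%:R).

Lemma ln_sub_le (x y : R) : 0 < x -> 0 < y -> ln x - ln y <= (x - y) / y.
Proof.
move=> x0 y0; rewrite -ln_div ?posrE//.
rewrite (_ : x / y = 1 + (x - y) / y); last by field; rewrite gt_eqF.
by apply: le_ln1Dx; rewrite ltr_pdivlMr//; lra.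
Qed.

Lemma lg_ge0 n : 0 <= lg n.
Proof. by case: n => [|n]; [rewrite ln0|rewrite ln_ge0// ler1n]. Qed.

Lemma ler_lg m n : (0 < m <= n)%N -> lg m <= lg n.
Proof.
by move=> /andP[m0 mn]; rewrite ler_ln ?posrE ?ltr0n ?ler_nat// (leq_trans m0).
Qed.

Lemma lg_le n : (0 < n)%N -> lg n <= n%:R - 1.
Proof.
move=> n0; have := @ln_sub_le n%:R 1; rewrite ln1 subr0 divr1 ltr0n n0 ltr01.
by apply.
Qed.

Lemma lgS_le k : (0 < k)%N -> lg k.+1 - lg k <= k%:R^-1.
Proof.
move=> k0; have := @ln_sub_le k.+1%:R k%:R; rewrite !ltr0n k0 => /(_ isT isT).
by rewrite -natrB// subSnn mul1r.
Qed.

Lemma lgS_ge k : (0 < k)%N -> k.+1%:R^-1 <= lg k.+1 - lg k.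
Proof.
move=> k0; have := @ln_sub_le k%:R k.+1%:R; rewrite !ltr0n k0 => /(_ isT isT).
by rewrite -(opprB k.+1%:R) -natrB// subSnn mulNr mul1r; ilra.
Qed.

Lemma psi0 : psi 0 = 0.
Proof. by rewrite /chebyshev_psi big_geq. Qed.

Lemma psiS N : psi N.+1 = psi N + Lam N.+1.
Proof. by rewrite /chebyshev_psi big_nat_recr. Qed.

Lemma harmS N : harm N.+1 = harm N + N.+1%:R^-1.
Proof. by rewrite /harmonic_sum big_nat_recr. Qed.

Lemma psi_ge0 N : 0 <= psi N.
Proof. by apply: sumr_ge0 => k _; apply: mangoldt_ge0. Qed.

Lemma psi_mono m n : (m <= n)%N -> psi m <= psi n.
Proof.
move=> /subnK <-; elim: (n - m)%N => // k IH.
by rewrite addSn psiS (le_trans IH)// lerDl mangoldt_ge0.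
Qed.

Lemma ln_fact N : lg N`! = \sum_(1 <= k < N.+1) lg k.
Proof.
elim: N => [|N IH]; first by rewrite big_geq// fact0 ln1.
by rewrite factS lnMn ?fact_gt0// big_nat_recr//= IH addrC.
Qed.

(** Legendre's formula. The range may exceed [M] because [M %/ d] is then 0; this lets [psi_halve]
    compare three factorials over one range. *)
Lemma sum_mangoldt_floor M N : (M <= N)%N ->
  \sum_(1 <= d < N.+1) Lam d * (M %/ d)%:R = lg M`!.
Proof.
move=> MN; rewrite (big_cat_nat (n := M.+1))//= [X in _ + X]big1_seq ?addr0.
  rewrite ln_fact; under [RHS]eq_big_nat => k /andP[k0 kM].
    rewrite -(@sum_mangoldt R k k) ?k0 ?leqnn//; over.
  rewrite -(sum_hyperbola M (fun d _ => Lam d)); apply: eq_bigr => d _.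
  by rewrite sumr_const_nat subn1 /= mulr_natr.
move=> d; rewrite mem_index_iota => /andP[_ /andP[dM _]].
by rewrite divn_small ?mulr0.
Qed.

Lemma sum_psi_div N : \sum_(1 <= m < N.+1) psi (N %/ m) = lg N`!.
Proof.
rewrite -(sum_mangoldt_floor (leqnn N)).
rewrite (sum_hyperbola_swap N (fun _ m => Lam m)).
by apply: eq_bigr => d _; rewrite sumr_const_nat subn1 /= mulr_natr.
Qed.

(** Chebyshev's argument: the logarithm of the binomial coefficient [N] over [a] is at most
    [N ln 2], while in its expansion by Legendre's formula every [d] in [(b, N]] has coefficient at
    least 1 and no coefficient is negative. *)
Lemma psi_halve N : psi N <= psi (N - N %/ 2) + N%:R.
Proof.
set a := (N %/ 2)%N; set b := (N - a)%N.
have abN : N = (a + b)%N by rewrite /b subnKC// leq_div.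
have ab : (a <= b)%N by rewrite /b /a; lia.
have aN : (a <= N)%N by rewrite leq_div.
have bN : (b <= N)%N by rewrite leq_subr.
have l2 : ln 2 <= 1 :> R by have := @lg_le 2 isT; lra.
have lfact : lg N`! - lg a`! - lg b`! <= N%:R.
  rewrite -(bin_fact aN) lnMn ?muln_gt0 ?fact_gt0 ?bin_gt0// lnMn ?fact_gt0//.
  rewrite -/b addrC addrA; apply: (@le_trans _ _ (lg (2 ^ N))).
    have : lg 'C(N, a) <= lg (2 ^ N) by apply: ler_lg; rewrite bin_gt0 aN bin_le_exp2.
    by lra.
  rewrite natrX lnXn ?ltr0n// -[_ *+ _]mulr_natr.
  by rewrite -[leRHS]mul1r ler_wpM2r.
suff: psi N - psi b <= lg N`! - lg a`! - lg b`! by lra.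
have -> : psi b = \sum_(1 <= d < N.+1) Lam d * (d <= b)%:R.
  rewrite /chebyshev_psi (big_nat_widen 1 b.+1 N.+1)// big_mkcond.
  by apply: eq_bigr => d _; rewrite andTb ltnS; case: leqP; rewrite ?mulr1 ?mulr0.
rewrite -(sum_mangoldt_floor (leqnn N)) -(sum_mangoldt_floor aN).
rewrite -(sum_mangoldt_floor bN) /chebyshev_psi -!sumrB.
rewrite ler_sum_nat// => d /andP[d0 dN].
rewrite -{1}[Lam d]mulr1 -!mulrBr ler_wpM2l ?mangoldt_ge0//.
suff : (1 + a %/ d + b %/ d <= N %/ d + (d <= b))%N.
  by rewrite -(@ler_nat R) !natrD; lra.
case: (leqP d b) => db.
  by rewrite {1}abN divnD// -addnA addnC leq_add2r leq_addr.
rewrite (divn_small db) (divn_small (leq_ltn_trans ab db)) !addn0.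
by rewrite divn_gt0.
Qed.

(** The constant 4 closes the induction: [N - N %/ 2 <= 3 N / 4] for [N >= 2], and
    [4 * (3 N / 4) + N = 4 N]. *)
Lemma psi_le N : psi N <= 4 * N%:R.
Proof.
elim/ltn_ind: N => -[|[|N]] IH; first by rewrite psi0 mulr0.
  by rewrite psiS psi0 mangoldt1 addr0 mulr1.
apply: (le_trans (psi_halve _)).
have lt : (N.+2 - N.+2 %/ 2 < N.+2)%N by lia.
have := IH _ lt; have : (4 * (N.+2 - N.+2 %/ 2) <= 3 * N.+2)%N by lia.
rewrite -(ler_nat R) !natrM; lra.
Qed.

Lemma stirling N : (0 < N)%N ->
  0 <= lg N`! - (N%:R * lg N - N%:R) <= 1 + lg N.
Proof.
elim: N => // -[|N] IH _; first by rewrite (_ : 1`! = 1)%N// ln1 mulr0; lra.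
have /andP[IH1 IH2] := IH isT.
rewrite factS lnMn ?fact_gt0//.
have := @lgS_le N.+1 isT; have := @lgS_ge N.+1 isT.
set x := lg N.+2; set y := lg N.+1 in IH1 IH2 *.
have n0 : 0 < N.+1%:R :> R by rewrite ltr0n.
have e : N.+2%:R = N.+1%:R + 1 :> R by rewrite -natr1.
rewrite e; set n : R := N.+1%:R in n0 IH1 IH2 *.
move=> h1 h2.
have h2' : n * (x - y) <= 1 by rewrite mulrC -ler_pdivlMr// mul1r.
have h1' : 1 <= (n + 1) * (x - y) by rewrite mulrC -ler_pdivrMr ?mul1r//; lra.
apply/andP; split; nra.
Qed.

Lemma sum_ln_div N : (0 < N)%N ->
  \sum_(1 <= d < N.+1) (lg N - lg d) <= N%:R.
Proof.
move=> N0; rewrite sumrB -ln_fact sumr_const_nat subn1 /=.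
by rewrite -[lg N *+ N]mulr_natl; have := stirling N0; lra.
Qed.

(** Passing to the next integer increases every logarithm [ln (N / d)] by [x <= 1 / N]. By
    [sum_ln_div] the cross term [2 x sum ln (N / d)] is at most 2 and the square term at most 1,
    whence 3. *)
Lemma sum_ln2_div N : \sum_(1 <= d < N.+1) (lg N - lg d) ^+ 2 <= 3 * N%:R.
Proof.
elim: N => [|[|N] IH]; first by rewrite big_geq// mulr0.
  by rewrite big_nat1 subrr expr0n /=; lra.
rewrite big_nat_recr//= subrr expr0n /= addr0.
have := @lgS_le N.+1 isT; have := @ler_lg N.+1 N.+2 (leqnSn _).
set x := lg N.+2 - lg N.+1 => x0' h; have x0 : 0 <= x by rewrite /x; lra.
have xn : x * N.+1%:R <= 1 by rewrite -ler_pdivlMr ?ltr0n// mul1r.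
have -> : \sum_(1 <= d < N.+2) (lg N.+2 - lg d) ^+ 2
  = \sum_(1 <= d < N.+2) (lg N.+1 - lg d) ^+ 2
    + 2 * x * (\sum_(1 <= d < N.+2) (lg N.+1 - lg d)) + x ^+ 2 * N.+1%:R.
  rewrite mulr_sumr -big_split/=.
  have -> : x ^+ 2 * N.+1%:R = \sum_(1 <= d < N.+2) x ^+ 2.
    by rewrite sumr_const_nat subn1 mulr_natr.
  rewrite -big_split/=.
  by apply: eq_bigr => d _; rewrite /x; ring.
have := @sum_ln_div N.+1 isT; move: IH.
have x1 : x <= 1.
  by apply: (le_trans h); rewrite invf_le1 ?ltr0n// ler1n.
have : N.+2%:R = N.+1%:R + 1 :> R by rewrite -natr1.
set A := \sum_(_ <= _ < _) _; set B := \sum_(_ <= _ < _) (_ - _).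
move=> -> IH BN.
have : x * B <= 1 by apply: le_trans xn; rewrite ler_wpM2l.
have : x ^+ 2 * N.+1%:R <= 1.
  rewrite expr2 -mulrA; apply: le_trans (_ : x * 1 <= _); last by rewrite mulr1.
  by rewrite ler_wpM2l.
by lra.
Qed.

Lemma harm_bounds N : (0 < N)%N -> lg N.+1 <= harm N <= 1 + lg N.
Proof.
elim: N => // -[|N] IH _.
  by rewrite harmS /harmonic_sum big_geq// ln1; have := @lg_le 2 isT; lra.
have /andP[IH1 IH2] := IH isT.
have := @lgS_le N.+2 isT; have := @lgS_ge N.+1 isT.
rewrite harmS; ilra.
Qed.

(** [harm N - ln (N + 1)] increases, [harm N - ln N] decreases, and they differ by at most [1 / N];
    [g] is the supremum of the first. *)
Lemma euler_constant :
  exists g : R, forall N, (0 < N)%N -> 0 <= harm N - lg N - g <= N%:R^-1.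
Proof.
pose u N := harm N - lg N.+1; pose v N := harm N - lg N.
have uS N : u N <= u N.+1.
  by rewrite /u harmS; have := @lgS_le N.+1 isT; ilra.
have vS N : (0 < N)%N -> v N.+1 <= v N.
  by move=> N0; rewrite /v harmS; have := lgS_ge N0; ilra.
have um m n : (m <= n)%N -> u m <= u n.
  by move=> /subnK <-; elim: (n - m)%N => // k IH; rewrite addSn (le_trans IH).
have vm m n : (0 < m)%N -> (m <= n)%N -> v n <= v m.
  move=> m0 /subnK <-; elim: (n - m)%N => // k IH.
  by rewrite addSn (le_trans (vS _ _))// addn_gt0 m0 orbT.
have uv m n : (0 < n)%N -> u m <= v n.
  move=> n0; apply: (@le_trans _ _ (u (maxn m n))); first by rewrite um// leq_maxl.
  apply: (@le_trans _ _ (v (maxn m n))); last by rewrite vm// leq_maxr.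
  by rewrite /u /v lerB// ler_lg// leqnSn andbT leq_max n0 orbT.
pose E := [set u n | n in [set: nat]]%classic.
have Es n : (0 < n)%N -> ubound E (v n).
  by move=> n0 _ [m _ <-]; apply: uv.
have E1 : has_sup E by split; [exists (u 0%N), 0%N|exists (v 1%N); apply: Es].
exists (sup E) => N N0; apply/andP; split.
  by rewrite subr_ge0; apply: ge_sup; [case: E1|apply: Es].
have : u N <= sup E by apply: ub_le_sup; [case: E1|exists N].
by have := lgS_le N0; rewrite /u; ilra.
Qed.

(** Removing the floors from Legendre's formula for [ln N!] costs at most [psi N <= 4 N]; then
    divide by [N]. *)
Lemma mertens N : (0 < N)%N ->
  `|\sum_(1 <= k < N.+1) Lam k / k%:R - lg N| <= 4.
Proof.
move=> N0; set S := \sum_(_ <= _ < _) _.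
have n0 : 0 < N%:R :> R by rewrite ltr0n.
have h1 : lg N`! <= N%:R * S.
  rewrite -(sum_mangoldt_floor (leqnn N)) mulr_sumr ler_sum_nat// => k /andP[k0 _].
  rewrite mulrCA ler_wpM2l ?mangoldt_ge0// ler_pdivlMr ?ltr0n//.
  by rewrite -natrM ler_nat leq_trunc_div.
have h2 : N%:R * S <= lg N`! + psi N.
  rewrite -(sum_mangoldt_floor (leqnn N)) mulr_sumr /chebyshev_psi -big_split /=.
  rewrite ler_sum_nat// => k /andP[k0 _].
  rewrite -[X in _ + X]mulr1 -mulrDr mulrCA ler_wpM2l ?mangoldt_ge0//.
  rewrite ler_pdivrMr ?ltr0n// natr1 -natrM ler_nat.
  by rewrite ltnW// ltn_ceil.
have h3 := psi_le N; have /andP[h4 h5] := stirling N0; have h6 := lg_le N0.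
suff: `|N%:R * (S - lg N)| <= N%:R * 4.
  by rewrite normrM (gtr0_norm n0) ler_pM2l.
by rewrite ler_norml mulrBr; lra.
Qed.

End Chebyshev.

(** * Selberg's formula *)

Lemma abel_summation {R : comNzRingType} (g h : nat -> R) N : g 0%N = 0 ->
  \sum_(1 <= m < N.+2) (g m - g m.-1) * h m
  = g N.+1 * h N.+1 + \sum_(1 <= m < N.+1) g m * (h m - h m.+1).
Proof.
move=> g0; elim: N => [|N IH].
  by rewrite big_nat1 [in RHS]big_geq//= g0 subr0 addr0.
rewrite big_nat_recr//= IH [in RHS]big_nat_recr//=.
ring.
Qed.

Definition rem_psi {R : realType} (N : nat) : R := chebyshev_psi N - N%:R.

(** The Dirichlet convolution of the Moebius function with [ln^2]. Its summatory function is
    accessible with error [O(N)] before anything is known about [psi] beyond Chebyshev's bound. *)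
Definition selberg_weight {R : realType} (k : nat) : R :=
  mangoldt k * ln k%:R
  + \sum_(1 <= d < k.+1 | (d %| k)%N) mangoldt d * mangoldt (k %/ d)%N.

(** Discrete form of the integral of [|R(t)| / t^2]; the weight is [1 / m - 1 / (m + 1)], which is
    what Abel summation produces. *)
Definition log_mean_rem {R : realType} (N : nat) : R :=
  \sum_(1 <= m < N.+1) `|rem_psi m| / (m%:R * m.+1%:R).

Section Selberg.
Variable R : realType.
Local Notation mu := (@moebius R).
Local Notation Lam := (@mangoldt R).
Local Notation psi := (@chebyshev_psi R).
Local Notation harm := (@harmonic_sum R).
Local Notation rem := (@rem_psi R).
Local Notation w := (@selberg_weight R).
Local Notation T := (@log_mean_rem R).
Local Notation lg n := (@ln R n%:R).

(** Group by [k = d * m] and write [ln (N / d) = ln (N / k) + ln (k / d)]. The first part survives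
    only at [k = 1] by [sum_moebius]; the second gives [Lam k] by [moebius_ln]. *)
Lemma tatuzawa_iseki N (f : nat -> R) : (0 < N)%N ->
  \sum_(1 <= d < N.+1) mu d * (lg N - lg d) *
     \sum_(1 <= m < (N %/ d).+1) f (d * m)%N
  = f 1%N * lg N + \sum_(1 <= k < N.+1) f k * Lam k.
Proof.
move=> N0; under eq_bigr do rewrite mulr_sumr.
rewrite (sum_hyperbola N (fun d m => mu d * (lg N - lg d) * f (d * m)%N)).
transitivity (\sum_(1 <= k < N.+1)
    (f k * ((lg N - lg k) * (k == 1%N)%:R) + f k * Lam k)).
  apply: eq_big_nat => k /andP[k0 kN].
  rewrite -mulrDr -(@sum_moebius R k k) ?k0 ?leqnn//.
  rewrite -(@moebius_ln R k k) ?k0 ?leqnn//.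
  rewrite mulr_sumr -big_split/= mulr_sumr.
  apply: eq_bigr => d dk; rewrite mulnC divnK//.
  by ring.
rewrite big_split/=; congr (_ + _).
rewrite big_nat_recl//= ln1 subr0 mulr1 big1_seq ?addr0// => i.
rewrite mem_index_iota => /andP[_ /andP[i1 _]].
by rewrite (_ : (i.+1 == 1)%N = false) ?mulr0//; lia.
Qed.

Lemma frac_bounds N k : (0 < k)%N ->
  (N %/ k)%:R <= N%:R / k%:R :> R /\ N%:R / k%:R <= (N %/ k)%:R + 1 :> R.
Proof.
move=> k0; rewrite ler_pdivlMr ?ltr0n// ler_pdivrMr ?ltr0n//.
by rewrite natr1 -!natrM !ler_nat leq_trunc_div ltnW// ltn_ceil.
Qed.

Lemma lg_frac N k : (0 < k <= N)%N ->
  0 <= lg N - lg k - lg (N %/ k) <= (N %/ k)%:R^-1.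
Proof.
move=> /andP[k0 kN]; have N0 := leq_trans k0 kN.
have M0 : (0 < N %/ k)%N by rewrite divn_gt0.
have h1 : lg (N %/ k * k) <= lg N.
  by apply: ler_lg; rewrite muln_gt0 M0 k0 leq_trunc_div.
have h2 : lg N <= lg ((N %/ k).+1 * k).
  by apply: ler_lg; rewrite N0 ltnW// ltn_ceil.
move: h1 h2 (@lgS_le R _ M0); rewrite !lnMn//; ilra.
Qed.

Lemma rem_psi_le N : `|rem N| <= 4 * N%:R.
Proof.
have := psi_le R N; have := psi_ge0 R N; have : 0 <= N%:R :> R by [].
by move=> *; rewrite /rem_psi ler_norml; lra.
Qed.

(** With [M = N %/ d] the sum is close to [(M ln M - M) - M (ln M + gamma) + g M], so the shift
    [g = gamma + 1] cancels everything of order [M] or more and leaves a logarithm. *)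
Lemma selberg_inner : exists g C : R, 0 <= C /\ forall N d, (0 < d <= N)%N ->
  `|\sum_(1 <= m < (N %/ d).+1)
      (psi (N %/ (d * m)) - N%:R / (d * m)%:R + g)| <= C * (1 + (lg N - lg d)).
Proof.
have [g gP] := euler_constant R; exists (g + 1), (3 + `|g|).
split; first by rewrite addr_ge0.
move=> N d dd; have /andP[d0 dN] := dd; set M := (N %/ d)%N.
have M0 : (0 < M)%N by rewrite divn_gt0.
have -> : \sum_(1 <= m < M.+1) (psi (N %/ (d * m)) - N%:R / (d * m)%:R + (g + 1))
   = lg M`! - N%:R / d%:R * harm M + (g + 1) * M%:R.
  rewrite big_split/= sumrB sumr_const_nat subn1 mulr_natr -sum_psi_div.
  congr (_ - _ + _); last rewrite /harmonic_sum mulr_sumr.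
    by apply: eq_bigr => m _; rewrite divnMA.
  by apply: eq_bigr => m _; rewrite natrM invfM mulrA.
have /andP[] := gP _ M0; have [] := @frac_bounds N d d0.
have /andP[] := stirling R M0; have /andP[] := lg_frac dd.
rewrite -/M; set y := N%:R / d%:R; move=> b1 _.
set s := lg M`! - _; set h := harm M - _ - _.
have -> : lg M`! = s + (M%:R * lg M - M%:R) by rewrite /s; ring.
have -> : harm M = h + g + lg M by rewrite /h; ring.
move=> s0 s1 y0 y1 h0 h1.
have l0 := lg_ge0 R M; have M1 : 1 <= M%:R :> R by rewrite ler1n.
have hM : h * M%:R <= 1 by rewrite -ler_pdivlMr ?mul1r// ltr0n.
have g0 : 0 <= `|g| by []; have /andP[g1 g2] : - `|g| <= g <= `|g| by rewrite -ler_norml.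
have gl := mulr_ge0 g0 l0.
(* What remains: the Stirling error, the fractional part of [N / d] times a logarithm, and [N / d]
   times the error of the harmonic sum. *)
rewrite (_ : _ - _ + _ = s - (y - M%:R) * (lg M + g) - y * h); last by ring.
have : 0 <= y * h <= 2.
  rewrite mulr_ge0//=; last by lra.
  by have : y * h <= (M%:R + 1) * h; [rewrite ler_wpM2r|nra].
have : `|(y - M%:R) * (lg M + g)| <= lg M + `|g|.
  rewrite normrM -[leRHS]mul1r ler_pM//.
    by rewrite ler_norml; lra.
  by rewrite (le_trans (ler_normD _ _))// ger0_norm.
set z := (y - _) * _; set t := y * h.
rewrite ler_norml => /andP[z1 z2] /andP[t1 t2].
have lN : lg M <= lg N - lg d by lra.
have := mulr_ge0 g0 (le_trans l0 lN).
by rewrite ler_norml; move: b1 lN; set L := lg N - lg d; nra.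
Qed.

(** Apply [tatuzawa_iseki] to [f]. The inner sums are [O(1 + ln (N / d))], and the sums of
    [ln (N / d)] and its square are [O(N)]. Since [f k] differs from [rem (N %/ k)] by the constant
    [g] and a fractional part, returning to [rem] costs [O(ln N + psi N) = O(N)]. *)
Lemma selberg_rem : exists C : R, 0 <= C /\ forall N, (0 < N)%N ->
  `|rem N * lg N + \sum_(1 <= k < N.+1) Lam k * rem (N %/ k)| <= C * N%:R.
Proof.
have [g [C [C0 HC]]] := selberg_inner.
exists (4 * C + 5 * `|g| + 4); split; first by rewrite !addr_ge0// mulr_ge0.
move=> N N0; pose f k := psi (N %/ k) - N%:R / k%:R + g.
have TI := tatuzawa_iseki f N0.
have B1 : `|f 1%N * lg N + \sum_(1 <= k < N.+1) f k * Lam k| <= 4 * C * N%:R.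
  rewrite -TI; apply: (le_trans (ler_norm_sum _ _ _)).
  apply: (@le_trans _ _ (\sum_(1 <= d < N.+1)
     (C * (lg N - lg d) + C * (lg N - lg d) ^+ 2))).
    rewrite ler_sum_nat// => d /andP[d0 dN].
    have L0 : 0 <= lg N - lg d by rewrite subr_ge0 ler_lg// d0.
    rewrite !normrM (ger0_norm L0) -mulrA.
    have := moebius_le1 R d; have := HC N d; rewrite d0 -ltnS => /(_ dN) h1 h2.
    rewrite -[leRHS]mul1r ler_pM// ?mulr_ge0//.
    apply: (le_trans (ler_wpM2l L0 h1)); rewrite le_eqVlt; apply/orP; left.
    by apply/eqP; ring.
  rewrite big_split/= -!mulr_sumr.
  have := sum_ln_div R N0; have := sum_ln2_div R N; move: C0.
  by set A := \sum_(_ <= _ < _) _; set B := \sum_(_ <= _ < _) _; nra.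
have fE k : (0 < k)%N -> rem (N %/ k) = f k - g + (N%:R / k%:R - (N %/ k)%:R).
  by move=> k0; rewrite /rem_psi /f; lra.
have f1 : rem N = f 1%N - g by rewrite /f /rem_psi divn1 divr1; lra.
have -> : rem N * lg N + \sum_(1 <= k < N.+1) Lam k * rem (N %/ k)
  = (f 1%N * lg N + \sum_(1 <= k < N.+1) f k * Lam k) - g * lg N - g * psi N
    + \sum_(1 <= k < N.+1) Lam k * (N%:R / k%:R - (N %/ k)%:R).
  rewrite f1 (_ : \sum_(_ <= _ < _) _ = \sum_(1 <= k < N.+1) f k * Lam k - g * psi N
    + \sum_(1 <= k < N.+1) Lam k * (N%:R / k%:R - (N %/ k)%:R)); first by ring.
  rewrite mulr_sumr -sumrB -big_split/=; apply: eq_big_nat => k /andP[k0 _].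
  by rewrite fE//; ring.
have B2 : 0 <= \sum_(1 <= k < N.+1) Lam k * (N%:R / k%:R - (N %/ k)%:R) <= psi N.
  apply/andP; split.
    rewrite big_nat_cond sumr_ge0// => k /andP[/andP[k0 _] _].
    rewrite mulr_ge0 ?mangoldt_ge0// subr_ge0.
    by have [] := @frac_bounds N k k0.
  rewrite ler_sum_nat// => k /andP[k0 _].
  rewrite -[leRHS]mulr1 ler_wpM2l ?mangoldt_ge0//.
  by have [] := @frac_bounds N k k0; lra.
have := psi_le R N; have := psi_ge0 R N; have := @lg_le R _ N0; have := lg_ge0 R N.
move: B1 B2; set A := _ + _; set B := \sum_(_ <= _ < _) _.
rewrite !ler_norml => /andP[a1 a2] /andP[b1 b2] l0 l1 p0 p1.
have g0 : 0 <= `|g| by []; have /andP[g1 g2] : - `|g| <= g <= `|g| by rewrite -ler_norml.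
have : `|g * lg N| <= `|g| * N%:R.
  by rewrite normrM ler_wpM2l// ger0_norm//; lra.
have : `|g * psi N| <= `|g| * (4 * N%:R) by rewrite normrM ler_wpM2l// ger0_norm.
rewrite !ler_norml => /andP[c1 c2] /andP[d1 d2].
by lra.
Qed.

Lemma sum_mangoldt_ln_div N :
  0 <= \sum_(1 <= k < N.+1) Lam k * (lg N - lg k) <= 4 * N%:R.
Proof.
apply/andP; split.
  rewrite big_nat_cond sumr_ge0// => k /andP[/andP[k0 kN] _].
  by rewrite mulr_ge0 ?mangoldt_ge0// subr_ge0 ler_lg// k0.
elim: N => [|[|N] IH]; first by rewrite big_geq// mulr0.
  by rewrite big_nat1 subrr mulr0.
rewrite big_nat_recr//= subrr mulr0 addr0.
have -> : \sum_(1 <= k < N.+2) Lam k * (lg N.+2 - lg k)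
  = \sum_(1 <= k < N.+2) Lam k * (lg N.+1 - lg k) + (lg N.+2 - lg N.+1) * psi N.+1.
  rewrite mulr_sumr -big_split/=; apply: eq_bigr => k _; ring.
have := @lgS_le R N.+1 isT; have := psi_le R N.+1; have := psi_ge0 R N.+1.
have e : N.+2%:R = N.+1%:R + 1 :> R by rewrite -natr1.
move=> p0 p1 l1.
have : (lg N.+2 - lg N.+1) * psi N.+1 <= N.+1%:R^-1 * (4 * N.+1%:R).
  rewrite ler_pM//.
  by rewrite subr_ge0 ler_lg//=.
by rewrite mulrCA mulVf ?pnatr_eq0// => ?; rewrite [in leRHS]e; lra.
Qed.

(** One [N ln N] comes from the term [- N] in [rem N], the other from
    [sum Lam k * (N %/ k) = ln N!]. Replacing [ln N] by [ln k] next to [Lam k] costs [O(N)] by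
    [sum_mangoldt_ln_div]. *)
Lemma selberg_weight_sum : exists C : R, 0 <= C /\ forall N, (0 < N)%N ->
  `|\sum_(1 <= k < N.+1) w k - 2 * N%:R * lg N| <= C * N%:R.
Proof.
have [C [C0 HC]] := selberg_rem; exists (C + 5); split; first by rewrite addr_ge0.
move=> N N0; have := HC N N0.
have -> : \sum_(1 <= k < N.+1) Lam k * rem (N %/ k)
  = \sum_(1 <= k < N.+1) Lam k * psi (N %/ k) - lg N`!.
  rewrite -(sum_mangoldt_floor R (leqnn N)) -sumrB.
  by apply: eq_bigr => k _; rewrite /rem_psi mulrBr.
have -> : \sum_(1 <= k < N.+1) w k = psi N * lg N
  - \sum_(1 <= k < N.+1) Lam k * (lg N - lg k)
  + \sum_(1 <= k < N.+1) Lam k * psi (N %/ k).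
  rewrite mulr_suml -sumrB.
  under [X in _ + X]eq_bigr do rewrite mulr_sumr.
  rewrite (sum_hyperbola N (fun d m => Lam d * Lam m)) -big_split/=.
  by apply: eq_bigr => k _; rewrite /selberg_weight; congr (_ + _); ring.
have /andP[] := stirling R N0; have /andP[] := sum_mangoldt_ln_div N.
have := @lg_le R _ N0; rewrite /rem_psi.
set A := \sum_(_ <= _ < _) _; set B := \sum_(_ <= _ < _) _.
move=> l1 a0 a1 s0 s1; rewrite !ler_norml => /andP[h1 h2]; lra.
Qed.

(** Multiply [selberg_rem] by [ln N] and split [ln N] as [ln k + ln (N %/ k)] up to a small error;
    [selberg_rem] at [N %/ k] handles the second part. Now both [Lam k * ln k] and the convolution
    of [Lam] with itself multiply [|rem|], which is [selberg_weight]. *)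
Lemma selberg_rem_iterated : exists C : R, 0 <= C /\ forall N, (0 < N)%N ->
  `|rem N| * lg N ^+ 2 <=
    \sum_(1 <= k < N.+1) w k * `|rem (N %/ k)| + C * N%:R * (1 + lg N).
Proof.
have [C [C0 HC]] := selberg_rem; exists (2 * C + 16); split.
  by rewrite addr_ge0// mulr_ge0.
move=> N N0; have L0 := lg_ge0 R N.
set S := \sum_(1 <= k < N.+1) Lam k * rem (N %/ k).
have h1 : `|rem N| * lg N ^+ 2 <= C * N%:R * lg N + `|lg N * S|.
  have -> : `|rem N| * lg N ^+ 2 = `|(rem N * lg N + S) * lg N - lg N * S|.
    rewrite [X in _ = `|X|](_ : _ = rem N * lg N ^+ 2); last by ring.
    by rewrite normrM [X in _ = _ * X]ger0_norm// exprn_ge0.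
  rewrite (le_trans (ler_normB _ _))// lerD2r normrM [X in _ * X]ger0_norm//.
  by rewrite ler_wpM2r// HC.
have h2 k : (0 < k <= N)%N -> `|lg N * rem (N %/ k)| <=
    lg k * `|rem (N %/ k)| + 4 + C * (N %/ k)%:R +
    \sum_(1 <= j < (N %/ k).+1) Lam j * `|rem (N %/ (k * j))|.
  move=> kk; have /andP[k0 kN] := kk; set M := (N %/ k)%N.
  have M0 : (0 < M)%N by rewrite divn_gt0.
  have /andP[] := lg_frac kk.
  rewrite -/M => t0 t1; have M1 : 0 < M%:R :> R by rewrite ltr0n.
  have a1 : `|(lg N - lg k - lg M) * rem M| <= 4.
    rewrite normrM (ger0_norm t0); apply: le_trans (_ : M%:R^-1 * (4 * M%:R) <= _).
      by rewrite ler_pM// rem_psi_le.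
    by rewrite mulrCA mulVf ?mulr1// gt_eqF.
  have a2 : `|lg M * rem M| <= C * M%:R +
      \sum_(1 <= j < M.+1) Lam j * `|rem (N %/ (k * j))|.
    rewrite -[X in `|X|](addrK (\sum_(1 <= j < M.+1) Lam j * rem (M %/ j))).
    rewrite (le_trans (ler_normB _ _))// lerD//; first by rewrite mulrC HC.
    rewrite (le_trans (ler_norm_sum _ _ _))// ler_sum// => j _.
    by rewrite normrM ger0_norm ?mangoldt_ge0// divnMA.
  rewrite (_ : lg N * rem M = lg k * rem M + (lg N - lg k - lg M) * rem M + lg M * rem M);
    last by ring.
  rewrite (le_trans (ler_normD _ _))// -[leRHS]addrA lerD//.
  by rewrite (le_trans (ler_normD _ _))// lerD// normrM ger0_norm// lg_ge0.
have h3 : `|lg N * S| <= \sum_(1 <= k < N.+1) Lam k *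
   (lg k * `|rem (N %/ k)| + 4 + C * (N %/ k)%:R +
    \sum_(1 <= j < (N %/ k).+1) Lam j * `|rem (N %/ (k * j))|).
  rewrite mulr_sumr (le_trans (ler_norm_sum _ _ _))// ler_sum_nat// => k /andP[k0 kN].
  rewrite mulrCA normrM ger0_norm ?mangoldt_ge0// ler_wpM2l ?mangoldt_ge0//.
  by rewrite h2// k0.
have E : \sum_(1 <= k < N.+1) Lam k *
   (lg k * `|rem (N %/ k)| + 4 + C * (N %/ k)%:R +
    \sum_(1 <= j < (N %/ k).+1) Lam j * `|rem (N %/ (k * j))|)
  = \sum_(1 <= k < N.+1) w k * `|rem (N %/ k)| + 4 * psi N + C * lg N`!.
  have -> : \sum_(1 <= k < N.+1) w k * `|rem (N %/ k)| =
    \sum_(1 <= k < N.+1) Lam k * lg k * `|rem (N %/ k)|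
    + \sum_(1 <= k < N.+1) \sum_(1 <= j < (N %/ k).+1)
         Lam k * Lam j * `|rem (N %/ (k * j))|.
    rewrite (sum_hyperbola N (fun d m => Lam d * Lam m * `|rem (N %/ (d * m))|)).
    rewrite -big_split/=; apply: eq_bigr => k _; rewrite mulrDl; congr (_ + _).
    by rewrite mulr_suml; apply: eq_bigr => d dk; rewrite [(d * _)%N]mulnC divnK.
  rewrite -(sum_mangoldt_floor R (leqnn N)) !mulr_sumr -!big_split/=.
  apply: eq_bigr => k _.
  rewrite (_ : \sum_(_ <= _ < _) _ * _ * _ = Lam k *
     \sum_(1 <= j < (N %/ k).+1) Lam j * `|rem (N %/ (k * j))|); first by ring.
  by rewrite mulr_sumr; apply: eq_bigr => j _; rewrite mulrA.
have := psi_le R N; have := @lg_le R _ N0; have /andP[] := stirling R N0.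
have n0 : 0 <= N%:R :> R by [].
move: h1 h3; rewrite E; set A := \sum_(_ <= _ < _) _.
move=> h1 h3 s0 s1 l1 p1.
have : C * lg N`! <= C * (N%:R * lg N) by rewrite ler_wpM2l//; lra.
have := mulr_ge0 C0 (mulr_ge0 n0 L0); have := mulr_ge0 n0 L0; have := mulr_ge0 C0 n0.
by lra.
Qed.

Lemma rem_psi0 : rem 0 = 0.
Proof. by rewrite /rem_psi psi0 subrr. Qed.

Lemma rem_psiS N : rem N.+1 = rem N + Lam N.+1 - 1.
Proof. by rewrite /rem_psi psiS -natr1; ring. Qed.

Lemma log_mean_rem0 : T 0 = 0.
Proof. by rewrite /log_mean_rem big_geq. Qed.

Lemma log_mean_remS N :
  T N.+1 = T N + `|rem N.+1| / (N.+1%:R * N.+2%:R).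
Proof. by rewrite /log_mean_rem big_nat_recr. Qed.

Lemma log_mean_rem_ge0 N : 0 <= T N.
Proof. by apply: sumr_ge0 => k _; rewrite mulr_ge0// invr_ge0 mulr_ge0. Qed.

Lemma log_mean_rem_le N : (0 < N)%N -> T N <= 4 * (1 + lg N).
Proof.
move=> N0; have /andP[_ h] := harm_bounds R N0.
apply: le_trans (_ : 4 * harm N <= _); last by rewrite ler_wpM2l.
rewrite mulr_sumr ler_sum_nat// => k /andP[k0 _].
rewrite ler_pdivrMr ?mulr_gt0 ?ltr0n// (le_trans (rem_psi_le _))//.
rewrite -mulrA ler_wpM2l// mulKf ?pnatr_eq0 -?lt0n//.
by rewrite ler_nat.
Qed.

(** The weight [w] is replaced by its average. After summation by parts only [W (n %/ m)] occurs,
    and it is close to [h m = 2 x ln x] with [x = n / m]. The error is paid by the variation of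
    [|rem|], at most [Lam m + 1] per step, which Mertens' estimate controls. Two further Abel
    summations move the differences from [|rem|] to [h] and then from [T] to [ln]. *)
Lemma selberg_tauberian : exists C : R, 0 <= C /\ forall N, (0 < N)%N ->
  `|rem N| * lg N ^+ 2 <=
    2 * N%:R * (\sum_(1 <= m < N) T m * (lg m.+1 - lg m))
    + C * N%:R * (1 + lg N).
Proof.
have [C [C0 HC]] := selberg_rem_iterated.
have [D [D0 HD]] := selberg_weight_sum.
exists (C + 5 * (D + 2) + 8); split; first by rewrite !addr_ge0// mulr_ge0// addr_ge0.
move=> [//|N] _; have := HC N.+1 isT; set n := N.+1.
have n0 : 0 <= n%:R :> R by []; have L0 := lg_ge0 R n.
pose g m : R := `|rem m|; pose W M := \sum_(1 <= k < M.+1) w k.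
pose h m := 2 * (n%:R / m%:R) * (lg n - lg m).
have e1 : \sum_(1 <= k < n.+1) w k * `|rem (n %/ k)|
  = \sum_(1 <= m < n.+1) (g m - g m.-1) * W (n %/ m)%N.
  transitivity (\sum_(1 <= k < n.+1) \sum_(1 <= m < (n %/ k).+1) w k * (g m - g m.-1)).
    apply: eq_bigr => k _; rewrite -mulr_sumr; congr (_ * _).
    rewrite big_add1 /= (telescope_sumr g)// /g rem_psi0 normr0.
    by rewrite subr0.
  rewrite sum_hyperbola_swap; apply: eq_bigr => m _.
  by rewrite mulr_sumr; apply: eq_bigr => k _; rewrite mulrC.
have Wh m : (0 < m <= n)%N -> `|W (n %/ m)%N - h m| <= (D + 2) * (n%:R / m%:R).
  move=> mn; have /andP[m0 mn'] := mn; rewrite /h.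
  have M0 : (0 < n %/ m)%N by rewrite divn_gt0.
  have /andP[] := lg_frac mn; have [] := @frac_bounds n m m0.
  have := HD _ M0; rewrite -/(W _); have := lg_ge0 R (n %/ m)%N; have := @lg_le R _ M0.
  set M := (n %/ m)%N; set y := n%:R / m%:R; set l := lg n - lg m.
  move=> l1 l0 hW y0 y1 t0 t1.
  have M1 : 1 <= M%:R :> R by rewrite ler1n.
  have t1' : (l - lg M) * M%:R <= 1 by rewrite -ler_pdivlMr ?mul1r// ltr0n.
  have t1'' : l - lg M <= 1.
    by apply: (le_trans t1); rewrite invf_le1 ?ltr0n.
  have ly : l <= y - 1.
    have := @ln_sub_le R n%:R m%:R; rewrite !ltr0n m0 => /(_ isT isT).
    by rewrite mulrBl divff// pnatr_eq0 -lt0n.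
  have : 0 <= y * l - M%:R * lg M <= y by nra.
  move: hW; rewrite !ler_norml => /andP[w1 w2] /andP[q1 q2].
  have : D * M%:R <= D * y by rewrite ler_wpM2l.
  by move=> dm; apply/andP; split; lra.
have gS m : (0 < m)%N -> `|g m - g m.-1| <= Lam m + 1.
  case: m => // m _; rewrite /g /= (le_trans (ler_dist_dist _ _))// rem_psiS.
  rewrite (_ : _ - _ = Lam m.+1 - 1); last by ring.
  by have := mangoldt_ge0 R m.+1; rewrite ler_norml => ?; lra.
have e2 : \sum_(1 <= m < n.+1) (g m - g m.-1) * W (n %/ m)%N
  <= \sum_(1 <= m < n.+1) (g m - g m.-1) * h m
     + (D + 2) * n%:R * \sum_(1 <= m < n.+1) (Lam m + 1) / m%:R.
  rewrite mulr_sumr -big_split/= ler_sum_nat// => m /andP[m0 mn].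
  rewrite -lerBlDl -mulrBr (le_trans (ler_norm _))// normrM.
  apply: le_trans (_ : (Lam m + 1) * ((D + 2) * (n%:R / m%:R)) <= _).
    by rewrite ler_pM// ?gS// Wh// m0.
  by rewrite le_eqVlt; apply/orP; left; apply/eqP; ring.
have e3 : \sum_(1 <= m < n.+1) (Lam m + 1) / m%:R <= 5 + 2 * lg n.
  have /andP[_ hb] := @harm_bounds R n isT; 
  rewrite (eq_bigr (fun m => Lam m / m%:R + m%:R^-1)) => [|m _]; last first.
    by rewrite mulrDl mul1r.
  have := @mertens R n isT; rewrite big_split/= -/(harm n) ler_norml; set A := \sum_(_ <= _ < _) _.
  by move=> /andP[? ?]; lra.
have e4 : \sum_(1 <= m < n.+1) (g m - g m.-1) * h m
    = \sum_(1 <= m < n) g m * (h m - h m.+1).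
  by rewrite abel_summation ?/g ?rem_psi0 ?normr0// /h subrr !mulr0 add0r.
(* Up to the factor [2 n], the difference of [h] is [ln (n / m) / (m (m + 1))] plus a term at most
   [1 / (m (m + 1))]; the latter is the [+ 1]. *)
have e5 : \sum_(1 <= m < n) g m * (h m - h m.+1) <=
    2 * n%:R * \sum_(1 <= m < n.+1) (T m - T m.-1) * (lg n - lg m + 1).
  apply: (@le_trans _ _ (2 * n%:R *
      \sum_(1 <= m < n) (T m - T m.-1) * (lg n - lg m + 1))); last first.
    rewrite ler_wpM2l ?mulr_ge0// [leRHS]big_nat_recr//= lerDl subrr add0r mulr1.
    by rewrite log_mean_remS addrAC subrr add0r mulr_ge0// invr_ge0 mulr_ge0.
  rewrite mulr_sumr ler_sum_nat// => -[//|m] /andP[m0 mn].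
  rewrite log_mean_remS [T _ + _ - _]addrAC subrr add0r -/(g m.+1).
  rewrite mulrCA -!mulrA ler_wpM2l ?/g// /h.
  have := @lgS_le R m.+1 isT.
  have x0 : 0 < m.+1%:R :> R by rewrite ltr0n.
  have -> : m.+2%:R = m.+1%:R + 1 :> R by rewrite -natr1.
  set x : R := m.+1%:R in x0 *; set a := ln (x + 1) - ln x => ha.
  rewrite (_ : _ - _ = 2 * n%:R * ((x * (x + 1))^-1 * (ln n%:R - ln x) + (x + 1)^-1 * a)).
    rewrite [leRHS](_ : _ = 2 * n%:R * ((x * (x + 1))^-1 * (ln n%:R - ln x)
        + (x + 1)^-1 * x^-1)); last by rewrite invfM; ring.
    rewrite ler_wpM2l ?mulr_ge0// lerD2l ler_wpM2l// invr_ge0.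
    by lra.
  by rewrite /a; field; apply/andP; split; lra.
have e6 : \sum_(1 <= m < n.+1) (T m - T m.-1) * (lg n - lg m + 1)
    = \sum_(1 <= m < n) T m * (lg m.+1 - lg m) + T n.
  rewrite abel_summation ?log_mean_rem0// subrr add0r mulr1 addrC; congr (_ + _).
  by apply: eq_bigr => m _; congr (_ * _); ring.
have e7 := @log_mean_rem_le n isT.
rewrite e1; move: e2; rewrite e4; move: e5; rewrite e6.
move: e3; set A := \sum_(_ <= _ < _) _ / _; set B := \sum_(1 <= m < n) T m * _.
set E := \sum_(1 <= m < n) g m * _; set F := \sum_(_ <= _ < _) _ * W _.
move=> e3 e5 e2 h1.
have : (D + 2) * n%:R * A <= (D + 2) * n%:R * (5 + 2 * lg n).
  by rewrite ler_wpM2l// mulr_ge0// addr_ge0.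
have : 2 * n%:R * T n <= 2 * n%:R * (4 * (1 + lg n)).
  by rewrite ler_wpM2l// mulr_ge0.
have := mulr_ge0 n0 L0; have := mulr_ge0 D0 (mulr_ge0 n0 L0).
by nra.
Qed.

End Selberg.

(** * The prime number theorem *)

Section PrimeNumberTheorem.
Variable R : realType.
Local Notation Lam := (@mangoldt R).
Local Notation psi := (@chebyshev_psi R).
Local Notation harm := (@harmonic_sum R).
Local Notation rem := (@rem_psi R).
Local Notation w := (@selberg_weight R).
Local Notation T := (@log_mean_rem R).
Local Notation lg n := (@ln R n%:R).

Lemma exists_nat_ge (x : R) : exists n, (0 < n)%N /\ x <= n%:R.
Proof.
exists (Num.truncn (Num.max x 0)).+1; split => //.
by rewrite ltW// (le_lt_trans _ (truncnS_gt _))// le_max lexx.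
Qed.

Lemma lg_unbounded (x : R) : exists K, (0 < K)%N /\ forall n, (K <= n)%N -> x <= lg n.
Proof.
have [K [K0 xK]] := exists_nat_ge (expR x); exists K; split => // n Kn.
apply: (@le_trans _ _ (lg K)); last by apply: ler_lg; rewrite K0.
by rewrite -[x]expRK ler_ln ?posrE ?expR_gt0 ?ltr0n.
Qed.

Lemma lg_small (d : R) : 0 < d -> exists n0, forall n, (n0 <= n)%N -> lg n <= d * n%:R.
Proof.
move=> d0; have [K [K0 hK]] := exists_nat_ge (2 / d).
have [n0 [n00 hn0]] := exists_nat_ge (2 * lg K / d).
exists n0 => n n0n; have n1 : (0 < n)%N by apply: leq_trans n0n.
have := @ln_sub_le R n%:R K%:R; rewrite !ltr0n n1 K0 => /(_ isT isT).
have Kp : 0 < K%:R :> R by rewrite ltr0n.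
rewrite mulrBl divff ?gt_eqF// => h.
have h1 : n%:R / K%:R <= d / 2 * n%:R.
  by rewrite mulrC ler_wpM2r// -(invf_div 2 d) lef_pV2 ?posrE ?divr_gt0.
have h2 : 2 * lg K <= d * n%:R.
  by rewrite mulrC [_ * n%:R]mulrC -ler_pdivrMr// mulrC (le_trans hn0)// ler_nat.
by lra.
Qed.

(** * Sign changes and small values of the remainder *)

Definition signed_mean N : R := \sum_(1 <= n < N.+1) rem n / (n%:R * n.+1%:R).

Lemma signed_meanE N : signed_mean N =
  \sum_(1 <= k < N.+1) Lam k / k%:R - psi N / N.+1%:R - harm N.+1 + 1.
Proof.
elim: N => [|N IH].
  rewrite /signed_mean !big_geq// psi0 mul0r harmS /harmonic_sum big_geq//.
  by rewrite invr1; ring.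
rewrite /signed_mean big_nat_recr//= -/(signed_mean N) IH [in RHS]big_nat_recr//=.
rewrite /rem_psi (harmS _ N.+1) psiS.
have x0 : 0 < N.+1%:R :> R by rewrite ltr0n.
have -> : N.+2%:R = N.+1%:R + 1 :> R by rewrite -natr1.
set x : R := N.+1%:R in x0 *; field.
by apply/andP; split; lra.
Qed.

(** The logarithms of Mertens' sum and of the harmonic sum cancel; 9 collects 4 from [mertens], 4
    from [psi_le] and 1 from [ln (N + 2) - ln (N + 1)]. *)
Lemma signed_mean_le N : `|signed_mean N| <= 9.
Proof.
case: N => [|N]; first by rewrite /signed_mean big_geq// normr0.
rewrite signed_meanE; have := @mertens R N.+1 isT; have := @harm_bounds R N.+2 isT.
have : lg N.+2 - lg N.+1 <= 1.
  by rewrite (le_trans (@lgS_le R N.+1 isT))// invf_le1 ?ltr0n// ler1n.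
have : lg N.+1 <= lg N.+3 by apply: ler_lg; rewrite /=; lia.
have : 0 <= psi N.+1 / N.+2%:R by rewrite divr_ge0// psi_ge0.
have : psi N.+1 / N.+2%:R <= 4.
  rewrite ler_pdivrMr ?ltr0n// (le_trans (psi_le _ _))// ler_wpM2l//.
  by rewrite ler_nat.
rewrite !ler_norml; set A := \sum_(_ <= _ < _) _; set B := psi _ / _.
by move=> ? ? ? ? /andP[? ?] /andP[? ?]; lra.
Qed.

(* Selberg's formula gives an upper bound of Brun-Titchmarsh type. *)
Lemma psi_short : exists C : R, 0 <= C /\ forall n m, (0 < n)%N -> (n <= m <= 2 * n)%N ->
  (psi m - psi n) * lg n <= 2 * (m%:R - n%:R) * lg n + C * m%:R.
Proof.
have [D [D0 HD]] := selberg_weight_sum R.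
exists (2 + 2 * D); split; first by rewrite addr_ge0// mulr_ge0.
move=> n m n0 /andP[nm mn]; have m0 := leq_trans n0 nm.
(* From [n] on, the sum of [w] minus [ln n * psi] does not decrease, since
   [w i >= Lam i * ln i >= Lam i * ln n]. *)
have h k : \sum_(1 <= i < n.+1) w i - lg n * psi n
    <= \sum_(1 <= i < (k + n).+1) w i - lg n * psi (k + n).
  elim: k => [|k IH]; first by rewrite add0n.
  apply: (le_trans IH); rewrite addSn [in leRHS]big_nat_recr//= psiS.
  suff: lg n * Lam (k + n).+1 <= w (k + n).+1 by lra.
  apply: (@le_trans _ _ (Lam (k + n).+1 * lg (k + n).+1)).
    by rewrite mulrC ler_wpM2l ?mangoldt_ge0// ler_lg// n0; lia.
  rewrite lerDl sumr_ge0// => d _; by rewrite mulr_ge0 ?mangoldt_ge0.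
have := h (m - n)%N; rewrite subnK//.
have := HD _ n0; have := HD _ m0; rewrite !ler_norml.
have := @ln_sub_le R m%:R n%:R; rewrite !ltr0n n0 m0 => /(_ isT isT).
have : (m%:R - n%:R) / n%:R <= 1 :> R.
  by rewrite ler_pdivrMr ?ltr0n// mul1r -natrB// ler_nat; lia.
set W1 := \sum_(_ <= _ < _) _; set W2 := \sum_(_ <= _ < _) _.
have nm' : n%:R <= m%:R :> R by rewrite ler_nat.
have m1 : 1 <= m%:R :> R by rewrite ler1n.
move=> q1 q2 /andP[a1 a2] /andP[b1 b2] q3.
have : m%:R * (lg m - lg n) <= m%:R by rewrite -[leRHS]mulr1 ler_wpM2l//; lra.
have : D * n%:R <= D * m%:R by rewrite ler_wpM2l.
by lra.
Qed.

Lemma sum_nat_diff (F : nat -> R) y M : (y <= M)%N ->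
  \sum_(1 <= m < M.+1) F m - \sum_(1 <= m < y.+1) F m = \sum_(y.+1 <= m < M.+1) F m.
Proof. by move=> yM; rewrite (big_cat_nat (n := y.+1))//= addrAC subrr add0r. Qed.

Lemma sum_subinterval (F : nat -> R) a b c d : (a <= c)%N -> (d <= b)%N ->
  \sum_(a <= m < b | (c <= m < d)%N) F m = \sum_(c <= m < d) F m.
Proof.
move=> ac db; rewrite [RHS](big_nat_widen c d b)// [RHS](big_nat_widenl c a)//.
by apply: eq_bigl => m /=; rewrite andbC.
Qed.

Lemma sum_invS_bounds y M : (y <= M)%N ->
  lg M.+2 - lg y.+2 <= \sum_(y.+1 <= m < M.+1) m.+1%:R^-1 <= lg M.+1 - lg y.+1.
Proof.
move=> /subnK <-; elim: (M - y)%N => [|k IH]; first by rewrite add0n big_geq// !subrr lexx.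
rewrite addSn big_nat_recr//=; last by lia.
have := @lgS_le R (k + y).+2 isT; have := @lgS_ge R (k + y).+1 isT.
move: IH; set S := \sum_(_ <= _ < _) _; ilra.
Qed.

(** A remainder of constant sign [s] and size at least [d n] moves the signed mean by
    [d (ln K - ln 3)] across the window, but that mean stays within 9 of zero at both ends. The
    [ln 3] absorbs [y + 2 <= 3 y]. *)
Lemma same_sign_window (s d : R) y K : (0 < y)%N -> (0 < K)%N ->
  (forall n, (y < n <= K * y)%N -> d * n%:R <= s * rem n) -> `|s| = 1 -> 0 <= d ->
  d * (lg K - lg 3) <= 18.
Proof.
move=> y0 K0 H s1 d0.
have yK : (y <= K * y)%N by rewrite leq_pmull.
have h : d * \sum_(y.+1 <= m < (K * y).+1) m.+1%:R^-1
    <= s * (signed_mean (K * y) - signed_mean y).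
  rewrite /signed_mean sum_nat_diff// !mulr_sumr ler_sum_nat// => n hn.
  have /andP[n0 n1] := hn; have np : 0 < n%:R :> R by rewrite ltr0n; lia.
  rewrite mulrA ler_pdivlMr ?(mulr_gt0 np) ?ltr0n// (le_trans _ (H n _))//.
  by rewrite mulrCA -!mulrA mulVf ?mulr1 ?pnatr_eq0// mulrC.
have [e1 _] := andP (sum_invS_bounds yK).
have e2 : lg K - lg 3 <= lg (K * y).+2 - lg y.+2.
  have : lg (K * y) <= lg (K * y).+2 by apply: ler_lg; rewrite muln_gt0 K0 y0; lia.
  have : lg y.+2 <= lg (3 * y) by apply: ler_lg; rewrite /=; lia.
  by rewrite !lnMn//; lra.
apply: (le_trans (ler_wpM2l d0 (le_trans e2 e1))); apply: (le_trans h).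
rewrite (le_trans (ler_norm _))// normrM s1 mul1r (le_trans (ler_normB _ _))//.
by have := signed_mean_le (K * y); have := signed_mean_le y; lra.
Qed.

(** Otherwise [|rem n| > d n] on the whole window. Down-steps are at most [1 <= d n] and up-steps at
    most [ln n <= d n / 2], so the sign is constant; [K] makes [d (ln K - ln 3)] at least 19,
    against the bound 18 of [same_sign_window]. *)
Lemma small_rem_window (d : R) : 0 < d -> exists K y0, (0 < K)%N /\ (0 < y0)%N /\
  forall y, (y0 <= y)%N -> exists n, (y < n <= K * y)%N /\ `|rem n| <= d * n%:R.
Proof.
move=> d0; have [K [K0 hK]] := lg_unbounded (19 / d + lg 3).
have [n0 hn0] := lg_small (divr_gt0 d0 (ltr0Sn R 1)).
have [n1 [n10 hn1]] := exists_nat_ge (d^-1).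
exists K, (maxn n0 n1); split => //; split; first by rewrite leq_max n10 orbT.
move=> y; rewrite geq_max => /andP[yn0 yn1]; have y0 := leq_trans n10 yn1.
apply/not_existsP => H.
have H' n : (y < n <= K * y)%N -> d * n%:R < `|rem n|.
  by move=> hn; rewrite ltNge; apply/negP => hle; apply: (H n).
have K1 : 19 <= d * (lg K - lg 3).
  by rewrite mulrC -ler_pdivrMr//; have := hK K (leqnn _); lra.
have dy n : (y <= n)%N -> 1 <= d * n%:R.
  move=> yn; rewrite mulrC -ler_pdivrMr// mul1r (le_trans hn1)// ler_nat.
  exact: leq_trans yn.
have [r0|r0] := leP 0 (rem y.+1).
  suff: d * (lg K - lg 3) <= 18 by lra.
  apply: (@same_sign_window 1 d y K) => //; rewrite ?normr1// ?ltW//.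
  have pos k : (y + k.+1 <= K * y)%N -> 0 <= rem (y + k.+1).
    elim: k => [|k IH] hk; first by rewrite addn1.
    have hk' : (y + k.+1 <= K * y)%N by lia.
    have := H' (y + k.+1)%N; rewrite hk' addnS ltnS leq_addr => /(_ isT).
    have := IH hk'; rewrite addnS => p; rewrite ger0_norm// => q; rewrite !addnS rem_psiS.
    have := mangoldt_ge0 R (y + k).+2; have := dy (y + k).+1 (leqW (leq_addr _ _)).
    by lra.
  move=> n hn; have /andP[n2 n3] := hn; rewrite mul1r.
  have := pos (n - y).-1; rewrite (_ : (y + _)%N = n); last by lia.
  by move=> /(_ n3) p; have := H' n hn; rewrite ger0_norm// => /ltW.
suff: d * (lg K - lg 3) <= 18 by lra.
apply: (@same_sign_window (-1) d y K) => //; rewrite ?normrN1// ?ltW//.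
have neg k : (y + k.+1 <= K * y)%N -> rem (y + k.+1) <= 0.
  elim: k => [|k IH] hk; first by rewrite addn1 ltW.
  have hk' : (y + k.+1 <= K * y)%N by lia.
  have := H' (y + k.+1)%N; rewrite hk' addnS ltnS leq_addr => /(_ isT).
  have := IH hk'; rewrite addnS => p; rewrite ler0_norm// => q; rewrite !addnS rem_psiS.
  have := @mangoldt_le R (y + k).+2 isT; have := hn0 (y + k).+2.
  have -> : (n0 <= (y + k).+2)%N by lia.
  have : (y + k).+2%:R = (y + k).+1%:R + 1 :> R by rewrite -natr1.
  have := dy (y + k).+1 (leqW (leq_addr _ _)); move: q.
  set z : R := (y + k).+1%:R.
  move=> q1 q2 e2 /(_ isT); rewrite [in leRHS]e2 => q3 q4; have z1 : 1 <= z by rewrite ler1n.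
  have := ler_wpM2l (ltW d0) z1; lra.
move=> n hn; have /andP[n2 n3] := hn; rewrite mulN1r.
have := neg (n - y).-1; rewrite (_ : (y + _)%N = n); last by lia.
by move=> /(_ n3) p; have := H' n hn; rewrite ler0_norm// => /ltW.
Qed.

(** Starting from [|rem n| <= d n], monotonicity of [psi] and [psi_short] let the remainder move by
    at most [(m - n) + d m <= 2 d m]. The window factor is doubled so that [[n, 2 n]] lies
    inside. *)
Lemma small_rem_interval (d : R) : 0 < d < 1 ->
  exists K y0, (1 < K)%N /\ (0 < y0)%N /\ forall y, (y0 <= y)%N ->
  exists n, [/\ (y < n)%N, (2 * n <= K * y)%N &
    forall m, (n <= m)%N -> m%:R <= n%:R + d * n%:R -> `|rem m| <= 3 * d * m%:R].
Proof.
move=> /andP[d0 d1]; have [K [y0 [K0 [y00 H]]]] := small_rem_window d0.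
have [C [C0 HC]] := psi_short.
have [n0 [n00 hn0]] := lg_unbounded (C / d + 1).
exists (2 * K)%N, (maxn y0 n0); split; first by lia.
split; first by rewrite leq_max y00.
move=> y; rewrite geq_max => /andP[yy0 yn0].
have [n [/andP[yn nK] hn]] := H y yy0; exists n; split => //.
  by rewrite -mulnA leq_mul2l.
move=> m nm hm; have np : (0 < n)%N by lia.
have n1 : 0 < n%:R :> R by rewrite ltr0n.
have m2n : (m <= 2 * n)%N.
  by rewrite -(ler_nat R) natrM; have : d * n%:R <= 1 * n%:R; [rewrite ler_wpM2r// ltW|lra].
have := HC n m np; rewrite nm m2n => /(_ isT).
have Ld : C / d + 1 <= lg n by apply: hn0; lia.
have L0 : 0 < lg n by have : 0 <= C / d; [rewrite divr_ge0// ltW|lra].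
have CL : C <= d * lg n by rewrite mulrC -ler_pdivrMr//; lra.
move=> h.
have h1 : psi m - psi n <= 2 * (m%:R - n%:R) + d * m%:R.
  rewrite -(ler_pM2r L0); apply: (le_trans h).
  by have := ler_wpM2r (ler0n R m) CL; lra.
have h2 : psi n <= psi m by apply: psi_mono.
have nm' : n%:R <= m%:R :> R by rewrite ler_nat.
have : d * n%:R <= d * m%:R by rewrite ler_wpM2l// ltW.
by move: hn; rewrite /rem_psi !ler_norml => /andP[? ?] ?; lra.
Qed.

Lemma log_mean_rem_mono m n : (m <= n)%N -> T m <= T n.
Proof.
move=> mn; rewrite -subr_ge0 /log_mean_rem sum_nat_diff//.
by apply: sumr_ge0 => k _; rewrite mulr_ge0// invr_ge0 mulr_ge0.
Qed.

Lemma log_mean_rem_gain (a : R) : 0 < a <= 4 ->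
  (forall e : R, 0 < e -> exists n0, forall n, (n0 <= n)%N -> `|rem n| <= (a + e) * n%:R) ->
  exists b D : R, [/\ 0 <= b, b < a, 0 <= D & forall m, (0 < m)%N -> T m <= b * lg m + D].
Proof.
move=> /andP[a0 a4] H; pose d := a / 6.
have d0 : 0 < d by rewrite divr_gt0.
have d1 : d < 1 by rewrite ltr_pdivrMr//; lra.
have [K [y0 [K1 [y00 Hw]]]] := @small_rem_interval d (introT andP (conj d0 d1)).
have K0 : (0 < K)%N by apply: ltnW.
pose L := lg K.
have L0 : 2^-1 <= L.
  have : lg 2 <= L by apply: ler_lg.
  by have := @lgS_ge R 1 isT; rewrite ln1; lra.
(* Chosen so that [(a + e) * L - a * d / 6 = (a - e) * L], where [a * d / 6] is the gain [s3] over
   one window; [d = a / 6] made the remainder at most [a / 2 * m] on the small interval. *)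
pose e := a * d / (12 * L).
have ad : 0 < a * d by rewrite mulr_gt0.
have eL : e * L = a * d / 12 by rewrite /e; field; lra.
have e0 : 0 < e by rewrite divr_gt0//; lra.
have [n0 hn0] := H e e0.
pose y1 := maxn y0 n0; pose b := a - e.
have bL : b * L = a * L - a * d / 12 by rewrite /b mulrBl eL.
have b0 : 0 <= b.
  rewrite /b /e subr_ge0 ler_pdivrMr; last by lra.
  by rewrite ler_wpM2l ?ltW//; lra.
have step y : (y1 <= y)%N -> T (K * y) - T y <= b * L.
  rewrite geq_max => /andP[yy0 yn0]; have yp : (0 < y)%N by apply: leq_trans yy0.
  have yK : (y <= K * y)%N by rewrite leq_pmull.
  have [n [yn nK Hn]] := Hw y yy0.
  have n1 : 0 < n%:R :> R by rewrite ltr0n; lia.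
  pose J := Num.truncn (d * n%:R).
  have dn0 : 0 <= d * n%:R by rewrite mulr_ge0// ltW.
  have /andP[J1 J2] : J%:R <= d * n%:R < J.+1%:R by apply: truncn_itv.
  have JN : (J <= n)%N.
    rewrite -(ler_nat R) (le_trans J1)// -[leRHS]mul1r ler_wpM2r//.
    exact: ltW.
  rewrite /log_mean_rem sum_nat_diff//.
  apply: (@le_trans _ _ (\sum_(y.+1 <= m < (K * y).+1)
      ((a + e) * m.+1%:R^-1 - (if (n <= m < (n + J).+1)%N then a / 2 * m.+1%:R^-1 else 0)))).
    rewrite ler_sum_nat// => m /andP[ym mK].
    have m0 : 0 < m%:R :> R by rewrite ltr0n (leq_trans _ ym).
    rewrite invfM mulrA; case: ifP => [/andP[nm mJ]|_].
      rewrite -mulrBl ler_wpM2r// ler_pdivrMr// (le_trans (Hn _ nm _))//.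
        rewrite (@le_trans _ _ (n + J)%:R) ?ler_nat// natrD; lra.
      by rewrite ler_wpM2r ?ltW// /d; lra.
    rewrite subr0 ler_wpM2r// ler_pdivrMr// hn0//.
    by rewrite (leq_trans yn0)// ltnW.
  rewrite sumrB -mulr_sumr -big_mkcond.
  have /andP[_ s1] := sum_invS_bounds yK.
  have s2 : lg (K * y).+1 - lg y.+1 <= L.
    have : lg (K * y).+1 <= lg (K * y.+1) by apply: ler_lg; rewrite mulnS /= -add1n leq_add2r.
    by rewrite lnMn//; rewrite /L; lra.
  (* There are [J + 1 >= d n] terms, each at least [a / 2 / (3 n)] because
     [m + 1 <= 2 n + 1 <= 3 n]. *)
  have s3 : a * d / 6 <= \sum_(y.+1 <= m < (K * y).+1 | (n <= m < (n + J).+1)%N)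
      a / 2 * m.+1%:R^-1.
    rewrite (_ : \sum_(_ <= _ < _ | _) _ = \sum_(n <= m < (n + J).+1) a / 2 * m.+1%:R^-1).
      apply: (@le_trans _ _ (\sum_(n <= m < (n + J).+1) a / 2 * (3 * n%:R)^-1)).
        rewrite sumr_const_nat (_ : ((n + J).+1 - n = J.+1)%N); last by rewrite -addnS addKn.
        rewrite -[leRHS]mulr_natr invfM.
        apply: (@le_trans _ _ (a / 2 * (3^-1 * n%:R^-1) * (d * n%:R))).
          rewrite le_eqVlt; apply/orP; left; apply/eqP; field.
          by rewrite gt_eqF.
        have c0 : 0 < a / 2 * (3^-1 * n%:R^-1) by rewrite !mulr_gt0 ?invr_gt0.
        by rewrite (ler_pM2l c0) ltW.
      rewrite ler_sum_nat// => m /andP[nm mJ].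
      have a2 : 0 <= a / 2 by rewrite divr_ge0// ltW.
      have c3 : 0 < 3 * n%:R :> R by rewrite mulr_gt0.
      rewrite ler_wpM2l// lef_pV2 ?posrE ?ltr0n// -natrM ler_nat.
      by move: mJ JN yn; clear; lia.
    by apply: sum_subinterval; [exact: yn|move: nK JN; clear; lia].
  have : (a + e) * \sum_(y.+1 <= m < (K * y).+1) m.+1%:R^-1 <= (a + e) * L.
    have ae : 0 <= a + e by rewrite addr_ge0// ltW.
    by rewrite ler_wpM2l// (le_trans s1).
  by rewrite bL; lra.
have y10 : (0 < y1)%N by rewrite leq_max y00.
have pow j : T (K ^ j * y1) <= T y1 + j%:R * (b * L).
  elim: j => [|j IH]; first by rewrite expn0 mul1n mul0r addr0.
  have := step (K ^ j * y1)%N; rewrite leq_pmull ?expn_gt0 ?K0// mulnA -expnS => /(_ isT).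
  by rewrite -[j.+1%:R]natr1; lra.
have bL0 : 0 <= b * L by rewrite mulr_ge0//; lra.
exists b, (T y1 + b * L); split => //; first by rewrite /b; lra.
  by rewrite addr_ge0// log_mean_rem_ge0.
move=> m m0; have blm : 0 <= b * lg m by rewrite mulr_ge0// lg_ge0.
have [my|ym] := leqP m y1; first by have := log_mean_rem_mono my; lra.
(* [j] windows fit between [y1] and [m]; one more passes [m], at a cost [b * L] included in the
   constant. *)
pose j := trunc_log K (m %/ y1).
have q0 : (0 < m %/ y1)%N by rewrite divn_gt0// ltnW.
have /andP[j1 j2] : (K ^ j <= m %/ y1 < K ^ j.+1)%N by apply: trunc_log_bounds.
have mj : (m <= K ^ j.+1 * y1)%N by rewrite ltnW// -ltn_divLR.
have h1 := log_mean_rem_mono mj; have h2 := pow j.+1.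
have h3 : j%:R * L <= lg m.
  rewrite /L mulr_natl -lnXn ?ltr0n// -natrX; apply: ler_lg.
  by rewrite expn_gt0 K0 (leq_trans j1)// leq_div.
have := ler_wpM2l b0 h3; move: h2; rewrite -[j.+1%:R]natr1; lra.
Qed.

(** Left Riemann sum for the integral of [s ds]: [y (x - y) <= (x^2 - y^2) / 2]. *)
Lemma sum_lg_lgS N : (0 < N)%N ->
  \sum_(1 <= m < N) lg m * (lg m.+1 - lg m) <= lg N ^+ 2 / 2.
Proof.
elim: N => // -[|N] IH _; first by rewrite big_geq// ln1 expr0n mul0r.
rewrite big_nat_recr//=; have := IH isT; have := sqr_ge0 (lg N.+2 - lg N.+1).
by set A := \sum_(_ <= _ < _) _; set x := lg N.+2; set y := lg N.+1; nra.
Qed.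

Lemma rem_psi_improve (a : R) : 0 < a <= 4 ->
  (forall e : R, 0 < e -> exists n0, forall n, (n0 <= n)%N -> `|rem n| <= (a + e) * n%:R) ->
  exists c : R, [/\ 0 <= c, c < a &
    exists n0, forall n, (n0 <= n)%N -> `|rem n| <= c * n%:R].
Proof.
move=> a04 H; have [b [D [b0 ba D0 HT]]] := log_mean_rem_gain a04 H.
have [C [C0 HC]] := selberg_tauberian R.
exists ((a + b) / 2); split; [lra|lra|].
have [n0 [n00 hn0]] := lg_unbounded (1 + (2 * D + 2 * C) / ((a - b) / 2)).
exists n0 => n n0n; have n1 : (0 < n)%N by apply: leq_trans n0n.
have np : 0 < n%:R :> R by rewrite ltr0n.
have ab : 0 < (a - b) / 2 by lra.
have q0 : 0 <= (2 * D + 2 * C) / ((a - b) / 2).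
  by rewrite divr_ge0 ?(ltW ab)// addr_ge0// mulr_ge0.
have L1 := hn0 n n0n.
have L0 : 0 < lg n by lra.
have CL : 2 * D + 2 * C <= (a - b) / 2 * lg n.
  by rewrite [leRHS]mulrC -ler_pdivrMr//; lra.
have hs : \sum_(1 <= m < n) T m * (lg m.+1 - lg m) <= b * (lg n ^+ 2 / 2) + D * lg n.
  apply: (@le_trans _ _ (\sum_(1 <= m < n) (b * (lg m * (lg m.+1 - lg m))
      + D * (lg m.+1 - lg m)))).
    rewrite ler_sum_nat// => m /andP[m0 _]; rewrite mulrA -mulrDl ler_wpM2r ?HT//.
    by rewrite subr_ge0; apply: ler_lg; rewrite m0 leqnSn.
  rewrite big_split/= -!mulr_sumr (telescope_sumr (fun m => lg m))// ln1 subr0.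
  by rewrite lerD2r ler_wpM2l// sum_lg_lgS.
have h := HC n n1.
have h2 : `|rem n| * lg n ^+ 2 <= n%:R * (b * lg n ^+ 2 + 2 * D * lg n + C * (1 + lg n)).
  apply: (le_trans h).
  have : 2 * n%:R * \sum_(1 <= m < n) T m * (lg m.+1 - lg m)
    <= 2 * n%:R * (b * (lg n ^+ 2 / 2) + D * lg n) by rewrite ler_wpM2l// mulr_ge0.
  by lra.
have h3 : b * lg n ^+ 2 + 2 * D * lg n + C * (1 + lg n) <= (a + b) / 2 * lg n ^+ 2.
  have := ler_wpM2r (ltW L0) CL.
  have : C <= C * lg n by rewrite -[leLHS]mulr1 ler_wpM2l//; lra.
  by lra.
rewrite -(ler_pM2r (exprn_gt0 2 L0)); apply: (le_trans h2).
by have := ler_wpM2l (ltW np) h3; lra.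
Qed.

(** [inf E] is the limsup of [|rem n| / n]. Were it positive, [rem_psi_improve] would give an
    element of [E] strictly below it. *)
Theorem prime_number_theorem_psi (e : R) : 0 < e ->
  exists n0, forall n, (n0 <= n)%N -> `|rem n| <= e * n%:R.
Proof.
pose E : set R := [set c | 0 <= c /\
  exists n0, forall n, (n0 <= n)%N -> `|rem n| <= c * n%:R]%classic.
have E4 : E 4 by split => //; exists 0%N => n _; apply: rem_psi_le.
have Elb : lbound E 0 by move=> c [].
have Einf : has_inf E by split; [exists 4|exists 0].
have i0 : 0 <= inf E by apply: lb_le_inf => //; exists 4.
have i4 : inf E <= 4 by apply: inf_lbound => //; exists 0.
have Hi : forall e : R, 0 < e -> exists n0, forall n, (n0 <= n)%N ->
    `|rem n| <= (inf E + e) * n%:R.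
  move=> d d0; have [c [c0 [n0 hc]] cd] := inf_adherent d0 Einf.
  exists n0 => n n0n; apply: (le_trans (hc n n0n)).
  by rewrite ler_wpM2r// ltW.
move=> e0; have [i1|i1] := ltP 0 (inf E); last first.
  have [n0 h] := Hi e e0; exists n0 => n /h /le_trans; apply.
  by rewrite ler_wpM2r//; lra.
have i14 : 0 < inf E <= 4 by rewrite i1.
have [c [c0 ci Hc]] := rem_psi_improve i14 Hi.
have : inf E <= c by apply: inf_lbound; [exists 0|split].
by lra.
Qed.

End PrimeNumberTheorem.

(** * Pairs of odd primes *)

(** [f n = c n^d + o(n^d)], written without a quotient so that it can be summed over [n]. *)
Definition asymp {R : realType} (f : nat -> R) (d : nat) (c : R) : Prop :=
  forall e : R, 0 < e -> exists n0, forall n, (n0 <= n)%N ->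
    `|f n - c * n%:R ^+ d| <= e * n%:R ^+ d.

Section PolynomialGrowth.
Variable R : realType.
Implicit Types (f g : nat -> R) (c e : R).

Lemma asymp_ext f g d c : (forall n, (0 < n)%N -> f n = g n) ->
  asymp f d c -> asymp g d c.
Proof.
move=> fg hf e e0; have [n0 h] := hf e e0; exists (maxn 1 n0) => n.
by rewrite geq_max => /andP[n1 n2]; rewrite -fg// h.
Qed.

Lemma asympD f g d c1 c2 : asymp f d c1 -> asymp g d c2 ->
  asymp (fun n => f n + g n) d (c1 + c2).
Proof.
move=> hf hg e e0; have e2 : 0 < e / 2 by rewrite divr_gt0.
have [n1 h1] := hf _ e2; have [n2 h2] := hg _ e2; exists (maxn n1 n2) => n.
rewrite geq_max => /andP[/h1 {}h1 /h2 {}h2].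
rewrite (_ : _ - _ = (f n - c1 * n%:R ^+ d) + (g n - c2 * n%:R ^+ d)); last by ring.
by rewrite (le_trans (ler_normD _ _))//; lra.
Qed.

Lemma asympZ f d c k : asymp f d c -> asymp (fun n => k * f n) d (k * c).
Proof.
move=> hf e e0; have k0 : 0 < `|k| + 1 by rewrite ltr_wpDl.
have [n1 h1] := hf _ (divr_gt0 e0 k0); exists n1 => n /h1 {}h1.
rewrite -mulrA -mulrBr normrM.
apply: (@le_trans _ _ ((`|k| + 1) * (e / (`|k| + 1) * n%:R ^+ d))).
  by rewrite ler_pM// lerDl.
by rewrite mulrA [_ * (e / _)]mulrC divfK// gt_eqF.
Qed.

Lemma asympMX f d c j : asymp f d c ->
  asymp (fun n => n%:R ^+ j * f n) (j + d) c.
Proof.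
move=> hf e e0; have [n1 h1] := hf _ e0; exists n1 => n /h1 {}h1.
rewrite exprD [c * _]mulrCA -mulrBr normrM ger0_norm ?exprn_ge0//.
by rewrite [e * _]mulrCA ler_wpM2l ?exprn_ge0.
Qed.

Lemma asymp_lower f d c : asymp f d c -> asymp f d.+1 0.
Proof.
move=> hf e e0; have [n1 h1] := hf _ ltr01.
have [n2 [n20 h2]] := exists_nat_ge ((1 + `|c|) / e).
exists (maxn n1 n2) => n; rewrite geq_max => /andP[/h1 {}h1 n2n].
rewrite mul0r subr0.
have x0 : 0 <= n%:R ^+ d :> R by rewrite exprn_ge0.
have : `|f n| <= (1 + `|c|) * n%:R ^+ d.
  rewrite -[f n](subrK (c * n%:R ^+ d)) (le_trans (ler_normD _ _))//.
  by rewrite mulrDl lerD// normrM [`|_ ^+ d|]ger0_norm.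
move=> /le_trans; apply; rewrite exprS mulrA ler_wpM2r//.
by rewrite [leRHS]mulrC -ler_pdivrMr// (le_trans h2)// ler_nat.
Qed.

Lemma sum_pow_bounds d N :
  0 <= N%:R ^+ d.+1 / d.+1%:R - \sum_(0 <= m < N) (m%:R : R) ^+ d <= N%:R ^+ d.
Proof.
have d0 : 0 < d.+1%:R :> R by rewrite ltr0n.
elim: N => [|N /andP[IH1 IH2]].
  by rewrite big_geq// expr0n mul0r subr0 lexx exprn_ge0.
rewrite big_nat_recr//=; set S := \sum_(_ <= _ < _) _ in IH1 IH2 *.
have e1 : N.+1%:R ^+ d.+1 - N%:R ^+ d.+1
    = \sum_(i < d.+1) N.+1%:R ^+ (d - i) * N%:R ^+ i :> R.
  by rewrite subrXX -natrB// subSnn mul1r.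
have NN : N%:R <= N.+1%:R :> R by rewrite ler_nat.
have e2 : d.+1%:R * N%:R ^+ d <= N.+1%:R ^+ d.+1 - N%:R ^+ d.+1 :> R.
  rewrite e1 -[d.+1 in leLHS]card_ord mulr_natl -sumr_const ler_sum// => i _.
  have id : (i <= d)%N by rewrite -ltnS.
  rewrite -{1}(subnK id) exprD ler_wpM2r ?exprn_ge0//.
  by rewrite lerXn2r ?nnegrE.
have e3 : N.+1%:R ^+ d.+1 - N%:R ^+ d.+1 <= d.+1%:R * N.+1%:R ^+ d :> R.
  rewrite e1 -[d.+1 in leRHS]card_ord mulr_natl -sumr_const ler_sum// => i _.
  have id : (i <= d)%N by rewrite -ltnS.
  rewrite -[d in leRHS](subnK id) exprD ler_wpM2l ?exprn_ge0//.
  by rewrite lerXn2r ?nnegrE.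
have q1 : N%:R ^+ d <= N.+1%:R ^+ d.+1 / d.+1%:R - N%:R ^+ d.+1 / d.+1%:R :> R.
  by rewrite -mulrBl ler_pdivlMr// mulrC.
have q2 : N.+1%:R ^+ d.+1 / d.+1%:R - N%:R ^+ d.+1 / d.+1%:R <= N.+1%:R ^+ d :> R.
  by rewrite -mulrBl ler_pdivrMr// mulrC.
move: IH1 IH2 q1 q2; set A := _ / _; set B := N.+1%:R ^+ d.+1 / _.
set X := _ ^+ d; set Y := N.+1%:R ^+ d => IH1 IH2 q1 q2.
by apply/andP; split; lra.
Qed.

(** [B] absorbs the finitely many exceptions; [weighted_pairs0_asymp] evaluates [theta] at [n - a],
    which may be small. *)
Lemma asymp_uniform f d c e : asymp f d c -> 0 < e ->
  exists B, 0 <= B /\ forall n, `|f n - c * n%:R ^+ d| <= e * n%:R ^+ d + B.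
Proof.
move=> hf e0; have [n0 h] := hf _ e0.
exists (\sum_(0 <= m < n0) `|f m - c * m%:R ^+ d|); split; first exact: sumr_ge0.
move=> n; have [/h {}h|nn0] := leqP n0 n; first by rewrite ler_wpDr// sumr_ge0.
rewrite ler_wpDl ?mulr_ge0 ?exprn_ge0 ?(ltW e0)//.
rewrite (bigD1_seq n) ?iota_uniq ?mem_index_iota//= lerDl.
exact: sumr_ge0.
Qed.

Lemma asymp_sum f d c : asymp f d c ->
  asymp (fun N => \sum_(0 <= m < N) f m) d.+1 (c / d.+1%:R).
Proof.
move=> hf e e0; have e4 : 0 < e / 4 by rewrite divr_gt0.
have [n0 h] := hf _ e4.
pose B : R := \sum_(0 <= m < n0) `|f m - c * m%:R ^+ d|.
have [n1 [n10 h1]] := exists_nat_ge (B / (e / 4)).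
have [n2 [n20 h2]] := exists_nat_ge (`|c| / (e / 4)).
exists (maxn n0 (maxn n1 n2)) => N; rewrite !geq_max => /and3P[N0 N1 N2].
have Np : (0 < N)%N by apply: leq_trans N1.
have N1' : 1 <= N%:R :> R by rewrite ler1n.
set X := N%:R ^+ d.+1; set Y : R := N%:R ^+ d.
have Y0 : 0 <= Y by rewrite exprn_ge0.
have XY : X = N%:R * Y by rewrite /X exprS.
have X0 : N%:R <= X by rewrite XY -[leLHS]mulr1 ler_wpM2l// exprn_ege1.
have /andP[p1 p2] := sum_pow_bounds d N.
set P := \sum_(0 <= m < N) m%:R ^+ d in p1 p2.
have -> : \sum_(0 <= m < N) f m - c / d.+1%:R * X
   = \sum_(0 <= m < N) (f m - c * m%:R ^+ d) - c * (X / d.+1%:R - P).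
  by rewrite sumrB -mulr_sumr -/P; ring.
have b1 : `|\sum_(0 <= m < N) (f m - c * m%:R ^+ d)| <= B + e / 4 * P.
  rewrite (le_trans (ler_norm_sum _ _ _))// (big_cat_nat (n := n0))//= lerD2l.
  rewrite /P [in leRHS](big_cat_nat (n := n0))//= mulrDr ler_wpDl//.
    by rewrite mulr_ge0 ?(ltW e4)// sumr_ge0// => m _; rewrite exprn_ge0.
  by rewrite mulr_sumr ler_sum_nat// => m /andP[m0 _]; apply: h.
have b2 : `|c * (X / d.+1%:R - P)| <= `|c| * Y.
  by rewrite normrM ler_wpM2l// ger0_norm.
have b3 : B <= e / 4 * X.
  rewrite [leRHS]mulrC -ler_pdivrMr// (le_trans h1)// (le_trans _ X0)//.
  by rewrite ler_nat.
have b4 : `|c| * Y <= e / 4 * X.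
  rewrite XY mulrA ler_wpM2r// [leRHS]mulrC -ler_pdivrMr// (le_trans h2)//.
  by rewrite ler_nat.
have b5 : e / 4 * P <= e / 4 * X.
  rewrite ler_wpM2l ?(ltW e4)//.
  apply: (@le_trans _ _ (X / d.+1%:R)); first by rewrite -subr_ge0.
  by rewrite ler_pdivrMr ?ltr0n// ler_peMr ?ler1n// (le_trans _ X0).
have eX : 0 <= e * X by rewrite mulr_ge0 ?exprn_ge0// ltW.
rewrite (le_trans (ler_normB _ _))//; move: b1 b2.
set u := `|_|; set v := `|_| => b1 b2; lra.
Qed.

End PolynomialGrowth.

Lemma sum_pairs {V : nmodType} N (F : nat -> nat -> V) :
  \sum_(1 <= k < N.+1) \sum_(1 <= a < k) F a (k - a)%N
  = \sum_(1 <= a < N.+1) \sum_(1 <= b < (N - a).+1) F a b.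
Proof.
elim: N => [|N IH]; first by rewrite !big_geq.
rewrite big_nat_recr//= IH [RHS]big_nat_recr//= subnn [in RHS](@big_geq _ _ _ 1 1)//.
rewrite addr0 -big_split/=; apply: eq_big_nat => a /andP[a0 aN].
rewrite subSn// [in RHS]big_nat_recr//=; congr (_ + _).
Qed.

(** * Logarithmic and uniform weights on ordered pairs of odd primes *)

Definition odd_prime_ln {R : realType} (k : nat) : R :=
  if odd_prime k then ln k%:R else 0.

Definition odd_theta {R : realType} (N : nat) : R :=
  \sum_(1 <= k < N.+1) odd_prime_ln k.

Definition weighted_pairs {R : realType} (j N : nat) : R :=
  \sum_(1 <= k < N.+1) k%:R ^+ j *
    \sum_(1 <= a < k) odd_prime_ln a * odd_prime_ln (k - a)%N.

Definition prime_pairs {R : realType} (j N : nat) : R :=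
  \sum_(1 <= k < N.+1) k%:R ^+ j *
    \sum_(1 <= a < k) (odd_prime a && odd_prime (k - a)%N)%:R.

Section PrimePairs.
Variable R : realType.
Local Notation Lam := (@mangoldt R).
Local Notation psi := (@chebyshev_psi R).
Local Notation u := (@odd_prime_ln R).
Local Notation theta := (@odd_theta R).
Local Notation lg n := (@ln R n%:R).

(* Uses [exp y >= (y / 3) ^ 3] with [y = e * ln n]. *)
Lemma ln_sqr_small (e d : R) : 0 < e -> 0 < d -> exists n0, forall n, (n0 <= n)%N ->
  (0 < n)%N /\ 1 <= lg n /\ lg n ^+ 2 <= d * expR (e * lg n).
Proof.
move=> e0 d0; pose k := d * (e / 3) ^+ 3.
have k0 : 0 < k by rewrite mulr_gt0// exprn_gt0// divr_gt0.
have [n0 [n00 h]] := lg_unbounded (1 + k^-1).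
exists n0 => n n0n; have n1 := leq_trans n00 n0n; have := h n n0n.
have k1 : 0 < k^-1 by rewrite invr_gt0.
set x := lg n => hx; split => //; split; first by lra.
have kx : 1 <= k * x by rewrite mulrC -ler_pdivrMr// mul1r; lra.
have ex : (e / 3 * x) ^+ 3 <= expR (e * x).
  rewrite (_ : e * x = (e / 3 * x) * 3%:R); last by field.
  rewrite expRM_natr lerXn2r ?nnegrE ?expR_ge0//.
    by rewrite mulr_ge0// ?divr_ge0// ?ltW//; lra.
  by apply: le_trans (expR_ge1Dx _); rewrite lerDr.
apply: le_trans (ler_wpM2l (ltW d0) ex).
rewrite (_ : d * _ = x ^+ 2 * (k * x)); last by rewrite /k; ring.
by rewrite -[leLHS]mulr1 ler_wpM2l// exprn_ge0//; lra.
Qed.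

Lemma odd_prime_ln_ge0 k : 0 <= u k.
Proof. by rewrite /odd_prime_ln; case: ifP => // _; apply: lg_ge0. Qed.

Lemma odd_prime_ln_le k : u k <= Lam k.
Proof.
rewrite /odd_prime_ln; case: ifP => [/andP[pk _]|_]; last exact: mangoldt_ge0.
by rewrite mangoldt_prime.
Qed.

Lemma odd_theta_le N : theta N <= psi N.
Proof. by apply: ler_sum => k _; apply: odd_prime_ln_le. Qed.

(* A prime power up to [N] that is not an odd prime is [p ^ e] with
   [p <= max 2 (sqrt N)] and [e <= log_2 N]. *)
Lemma psi_sub_odd_theta N : (3 < N)%N ->
  psi N - theta N <= 3 * expR (2^-1 * lg N) * (lg N * (1 + 2 * lg N)).
Proof.
move=> N3; have N0 : (0 < N)%N by apply: leq_trans N3.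
pose s := Num.truncn (expR (2^-1 * lg N)); pose t := trunc_log 2 N.
pose bad := [seq k <- index_iota 1 N.+1 | u k != Lam k].
have x0 : 0 <= expR (2^-1 * lg N) by rewrite expR_ge0.
have /andP[s1 s2] : s%:R <= expR (2^-1 * lg N) < s.+1%:R by apply: truncn_itv.
have xx : expR (2^-1 * lg N) ^+ 2 = N%:R.
  by rewrite -expRM_natr mulrAC mulVf// mul1r lnK ?posrE ?ltr0n.
have sN k : (k ^ 2 <= N)%N -> (k <= s)%N.
  move=> kN; rewrite -ltnS -(ltr_nat R); apply: le_lt_trans s2.
  by rewrite -(@ler_pXn2r _ 2) ?nnegrE// xx -natrX ler_nat.
have sz : (size bad <= (maxn 2 s).+1 * t.+1)%N.
  pose al := [seq (p ^ e)%N | p <- iota 0 (maxn 2 s).+1, e <- iota 0 t.+1].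
  rewrite (_ : (_ * _)%N = size al); last by rewrite size_allpairs !size_iota.
  apply: uniq_leq_size; first by rewrite filter_uniq// iota_uniq.
  move=> k; rewrite mem_filter mem_index_iota => /and3P[uk k0 kN].
  move: uk; rewrite /odd_prime_ln /mangoldt.
  case: ifP => [/andP[pk ok]|nop].
    by rewrite primes_prime//= pdiv_id// eqxx.
  case: ifP => [/prime_powerP[pp kE] _|_]; last by rewrite eqxx.
  have kN' : (k <= N)%N by rewrite -ltnS.
  set p := pdiv k in pp kE; set e := logn p k in kE.
  have e0 : (0 < e)%N by rewrite logn_gt0 mem_primes pp k0 pdiv_dvd.
  apply/allpairsP; exists (p, e); split; last exact: kE;
    rewrite mem_iota add0n ltnS leq0n andTb.
    rewrite /=; have [e1|e1] := leqP e 1; last first.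
      rewrite leq_max sN ?orbT// (leq_trans _ kN')//.
      by rewrite [X in (_ <= X)%N]kE leq_exp2l// prime_gt1.
    have e1' : e = 1%N by apply/eqP; rewrite eqn_leq e1 e0.
    have ek : k = p by rewrite [LHS]kE e1' expn1.
    have := nop; rewrite /odd_prime ek pp /= => /negbT.
    by case: (even_prime pp) => [-> _|->//]; rewrite leq_maxl.
  rewrite /= /t; apply: trunc_log_max => //; rewrite (leq_trans _ kN')//.
  by rewrite [X in (_ <= X)%N]kE leq_exp2r// prime_gt1.
have -> : psi N - theta N = \sum_(k <- bad) (Lam k - u k).
  rewrite -sumrB big_filter [RHS]big_mkcond; apply: eq_bigr => k _.
  by case: eqP => [->|]; rewrite ?subrr.
have b1 : \sum_(k <- bad) (Lam k - u k) <= \sum_(k <- bad) lg N.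
  rewrite big_seq [leRHS]big_seq ler_sum// => k.
  rewrite mem_filter mem_index_iota => /and3P[_ k0 kN].
  rewrite (@le_trans _ _ (Lam k))//; first by rewrite gerBl odd_prime_ln_ge0.
  by rewrite (le_trans (mangoldt_le _ k0))// ler_lg// k0.
apply: (le_trans b1); rewrite big_const_seq count_predT iter_addr_0 -[leLHS]mulr_natr.
have L0 := lg_ge0 R N.
rewrite [leRHS]mulrCA ler_wpM2l//.
have szR : (size bad)%:R <= (maxn 2 s).+1%:R * t.+1%:R :> R by rewrite -natrM ler_nat.
apply: (le_trans szR).
have t1 : t.+1%:R <= 1 + 2 * lg N :> R.
  have : lg (2 ^ t) <= lg N.
    by apply: ler_lg; rewrite expn_gt0/= trunc_logP.
  rewrite natrX lnXn ?ltr0n// -[_ *+ t]mulr_natr => tl.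
  have l2 : 2^-1 <= lg 2 by have := @lgS_ge R 1 isT; rewrite ln1 subr0.
  have : t%:R * 2^-1 <= t%:R * lg 2 :> R by rewrite ler_wpM2l.
  rewrite -[t.+1%:R]natr1 [_ * lg 2]mulrC => /le_trans /(_ tl); lra.
have s3 : (maxn 2 s).+1%:R <= 3 * expR (2^-1 * lg N) :> R.
  have x1 : 1 <= expR (2^-1 * lg N).
    by rewrite -[leLHS]expR0 ler_expR mulr_ge0.
  rewrite -[(maxn 2 s).+1%:R]natr1 /maxn; case: ifP => _; last by lra.
  have s2' : (2 <= s)%N by apply: sN.
  have : 2 <= s%:R :> R by rewrite ler_nat.
  by lra.
by rewrite ler_pM.
Qed.

Lemma odd_theta_asymp : asymp theta 1 1.
Proof.
move=> e e0; have e2 : 0 < e / 2 by rewrite divr_gt0.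
have [n1 h1] := prime_number_theorem_psi e2.
have h0 : 0 < 2^-1 :> R by rewrite invr_gt0.
(* Once [ln n >= 1] the prime power error is at most [9 x ln^2 n] with [x = sqrt n], and
   [9 * (e / 18) * x^2 = e n / 2]. *)
have e18 : 0 < e / 18 by rewrite divr_gt0.
have [n2 h2] := ln_sqr_small h0 e18.
exists (maxn 4 (maxn n1 n2)) => n; rewrite !geq_max => /and3P[n4 /h1 {}h1 /h2 [n0 [l1 h3]]].
rewrite expr1 mul1r; have := psi_sub_odd_theta n4; have := odd_theta_le n.
move: h1; rewrite /rem_psi; set x := expR _ in h3 *.
have xx : x * x = n%:R.
  by rewrite /x -expRD -mulrDl (_ : 2^-1 + 2^-1 = 1) ?mul1r ?lnK ?posrE ?ltr0n//; lra.
have x0 : 0 < x by rewrite expR_gt0.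
move: l1 h3; set l := lg n => l1 h3 h4 h5 h6.
have : 3 * x * (l * (1 + 2 * l)) <= 3 * x * (3 * l ^+ 2).
  by rewrite ler_wpM2l ?mulr_ge0 ?(ltW x0)//; nra.
have : 3 * x * (3 * l ^+ 2) <= 3 * x * (3 * (e / 18 * x)).
  by rewrite ler_wpM2l ?mulr_ge0 ?(ltW x0)// ler_wpM2l.
rewrite [X in _ <= X -> _](_ : _ = e / 2 * (x * x)); last by field.
rewrite xx; move: h4; rewrite !ler_norml => /andP[? ?] ? ?; lra.
Qed.

Lemma sum_odd_theta N :
  \sum_(1 <= a < N.+1) u a * (N - a)%:R = \sum_(0 <= m < N) theta m.
Proof.
elim: N => [|N IH]; first by rewrite !big_geq.
rewrite [RHS]big_nat_recr//= -IH big_nat_recr//= subnn mulr0 addr0 -big_split/=.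
apply: eq_big_nat => a /andP[a0 aN].
by rewrite subSn// -natr1 mulrDr mulr1.
Qed.

Lemma weighted_pairs0E N :
  weighted_pairs 0 N = \sum_(1 <= a < N.+1) u a * theta (N - a).
Proof.
rewrite /weighted_pairs; under eq_bigr do rewrite expr0 mul1r.
rewrite (sum_pairs N (fun a b => u a * u b)).
by apply: eq_bigr => a _; rewrite /odd_theta mulr_sumr.
Qed.

(** Replacing [theta (n - a)] by [n - a] costs at most [theta n * (e / 8) n <= (e / 2) n^2]; what is
    left is [sum_(m < n) theta m], of order [n^2 / 2]. *)
Lemma weighted_pairs0_asymp : asymp (@weighted_pairs R 0) 2 (1 / 2).
Proof.
move=> e e0; have e8 : 0 < e / 16 by rewrite divr_gt0.
have e2 : 0 < e / 2 by rewrite divr_gt0.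
have [B [B0 hB]] := asymp_uniform odd_theta_asymp e8.
have [n1 h1] := asymp_sum odd_theta_asymp e2.
have [n2 [n20 h2]] := exists_nat_ge (B / (e / 16)).
exists (maxn n1 n2) => n; rewrite geq_max => /andP[/h1 {}h1 nn2].
rewrite weighted_pairs0E; move: h1; rewrite -sum_odd_theta.
have hd : `|\sum_(1 <= a < n.+1) u a * theta (n - a) -
     \sum_(1 <= a < n.+1) u a * (n - a)%:R| <= 4 * n%:R * (e / 8 * n%:R).
  rewrite -sumrB (le_trans (ler_norm_sum _ _ _))//.
  apply: (@le_trans _ _ (theta n * (e / 8 * n%:R))); last first.
    rewrite ler_wpM2r ?mulr_ge0 ?divr_ge0 ?(ltW e0)//.
    exact: le_trans (odd_theta_le _) (psi_le _ _).
  rewrite /odd_theta mulr_suml ler_sum// => a _.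
  rewrite -mulrBr normrM ger0_norm ?odd_prime_ln_ge0// ler_wpM2l ?odd_prime_ln_ge0//.
  have := hB (n - a)%N; rewrite expr1 mul1r => /le_trans; apply.
  have : e / 16 * (n - a)%:R <= e / 16 * n%:R :> R.
    by rewrite ler_wpM2l ?(ltW e8)// ler_nat leq_subr.
  have : B <= e / 16 * n%:R.
    by rewrite [leRHS]mulrC -ler_pdivrMr// (le_trans h2)// ler_nat.
  by lra.
move: hd; rewrite !ler_norml; set A := \sum_(_ <= _ < _) _.
set A' := \sum_(_ <= _ < _) _ * (_)%:R.
by move=> /andP[? ?] /andP[? ?]; lra.
Qed.

(** With [weighted_pairs 0 m] close to [m^2 / 2], the leading coefficient is
    [1 / 2 - j / (2 (j + 2)) = 1 / (j + 2)]. *)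
Lemma weighted_pairs_abel j N : weighted_pairs j N = N%:R ^+ j * weighted_pairs 0 N -
  \sum_(0 <= m < N) weighted_pairs 0 m * (m.+1%:R ^+ j - m%:R ^+ j) :> R.
Proof.
elim: N => [|N IH].
  by rewrite /weighted_pairs !big_geq// mulr0 subr0.
rewrite [in LHS]/weighted_pairs big_nat_recr//= -/(weighted_pairs j N) IH.
rewrite {3}/weighted_pairs [in RHS]big_nat_recr//= -/(weighted_pairs 0 N).
rewrite [in RHS](big_nat_recr N 0%N)//= expr0 mul1r.
by ring.
Qed.

Lemma weighted_pairs1_asymp : asymp (@weighted_pairs R 1) 3 (1 / 3).
Proof.
have := asympD (asympMX 1 weighted_pairs0_asymp)
  (asympZ (-1) (asymp_sum weighted_pairs0_asymp)).
rewrite (_ : 1 / 2 + _ = 1 / 3); last by field.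
apply: asymp_ext => n _; rewrite (weighted_pairs_abel 1) mulN1r; congr (_ - _).
apply: eq_bigr => m _; rewrite !expr1 -natrB// subSnn mulr1.
by [].
Qed.

Lemma weighted_pairs2_asymp : asymp (@weighted_pairs R 2) 4 (1 / 4).
Proof.
have hs : asymp (fun m => weighted_pairs 0 m * (m.+1%:R ^+ 2 - m%:R ^+ 2)) 3 (1 : R).
  have := asympD (asympZ 2 (asympMX 1 weighted_pairs0_asymp))
    (asymp_lower weighted_pairs0_asymp).
  rewrite (_ : 2 * (1 / 2) + 0 = 1); last by field.
  by apply: asymp_ext => n _; rewrite -natr1; ring.
have := asympD (asympMX 2 weighted_pairs0_asymp) (asympZ (-1) (asymp_sum hs)).
rewrite (_ : 1 / 2 + _ = 1 / 4); last by field.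
by apply: asymp_ext => n _; rewrite (weighted_pairs_abel 2) mulN1r.
Qed.

Lemma count_lt (y : R) k : 0 <= y -> \sum_(1 <= a < k) (a%:R < y)%R%:R <= y.
Proof.
move=> y0; suff [] : \sum_(1 <= a < k) (a%:R < y)%R%:R <= y /\
    \sum_(1 <= a < k) (a%:R < y)%R%:R <= k%:R :> R by [].
elim: k => [|[|k] [IH1 IH2]]; first by rewrite big_geq.
  by rewrite big_geq.
rewrite big_nat_recr//=; have e : k.+2%:R = k.+1%:R + 1 :> R by rewrite -natr1.
have IH3 : \sum_(1 <= i < k.+1) (i%:R < y)%R%:R <= k%:R :> R.
  rewrite (@le_trans _ _ (\sum_(1 <= i < k.+1) 1))//.
    by rewrite ler_sum// => i _; case: (_ < _).
  by rewrite sumr_const_nat subn1.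
have e' : k.+1%:R = k%:R + 1 :> R by rewrite -natr1.
move: IH1 IH2 IH3 e e'; set S := \sum_(_ <= _ < _) _.
by case: ltP => h /= *; split; lra.
Qed.

(** Each weight is at most [ln^2 N]. Conversely it is at least [(1 - ep)^2 ln^2 N] unless a member
    lies below [y = N^(1 - ep)], and at most [2 y] pairs with a given sum are of that kind; their
    total is negligible because [y ln^2 N <= d N]. *)
Lemma prime_pairs_asymp j c : 0 <= c -> asymp (@weighted_pairs R j) (j + 2) c ->
  asymp (fun N => lg N ^+ 2 * prime_pairs j N) (j + 2) c.
Proof.
(* [e <= 1] gives [ep <= 1 / 4], so [1 - 2 ep], a lower bound for [(1 - ep)^2], is positive and can
   be divided by. The choice of [ep] makes [2 ep (c + e) <= e / 2], and [d = e / 6] makes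
   [d + 2 d = e / 2]. *)
move=> c0 hw e' e'0; pose e := Num.min e' 1.
have e0 : 0 < e by rewrite lt_min e'0 ltr01.
have e1 : e <= 1 by rewrite ge_min lexx orbT.
have ee : e <= e' by rewrite ge_min lexx.
pose ep := e / (4 * (c + 1)); pose d := e / 6.
have c1 : 0 < 4 * (c + 1) by lra.
have ep0 : 0 < ep by rewrite divr_gt0.
have d0 : 0 < d by rewrite divr_gt0.
have epc : ep * (c + 1) = e / 4 by rewrite /ep; field; lra.
have ep1 : ep <= 1 / 4 by rewrite ler_pdivrMr//; lra.
have [n1 h1] := hw d d0; have [n2 h2] := ln_sqr_small ep0 d0.
exists (maxn n1 n2) => N; rewrite geq_max => /andP[/h1 {}h1 /h2 [N0 [l1 h3]]].
set X := N%:R ^+ (j + 2) in h1 *; set P := prime_pairs j N.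
have X0 : 0 <= X by rewrite exprn_ge0.
have L0 : 0 <= lg N by lra.
have lo : weighted_pairs j N <= lg N ^+ 2 * P.
  rewrite /P /prime_pairs mulr_sumr ler_sum_nat// => k /andP[k0 kN].
  rewrite mulrCA ler_wpM2l ?exprn_ge0// mulr_sumr ler_sum_nat// => a /andP[a0 ak].
  rewrite /odd_prime_ln; case: ifP => _; last by rewrite mul0r mulr_ge0 ?exprn_ge0.
  case: ifP => _; last by rewrite !mulr0.
  by rewrite mulr1 expr2 ler_pM// ?lg_ge0// ler_lg//; move: a0 ak kN; clear; lia.
pose y := expR ((1 - ep) * lg N).
have y0 : 0 <= y by rewrite expR_ge0.
have yN : y * lg N ^+ 2 <= d * N%:R.
  have NE : N%:R = y * expR (ep * lg N) :> R.
    rewrite /y -expRD -mulrDl subrK mul1r lnK//.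
    by rewrite posrE ltr0n.
  by rewrite [in leRHS]NE [leRHS]mulrCA ler_wpM2l.
have up : (1 - ep) ^+ 2 * (lg N ^+ 2 * P) <= weighted_pairs j N + 2 * d * X.
  apply: (@le_trans _ _ (weighted_pairs j N + lg N ^+ 2 * (N%:R ^+ j * (N%:R * (2 * y))))); last first.
    rewrite lerD2l /X exprD.
    have : N%:R ^+ j * N%:R * 2 * (y * lg N ^+ 2) <= N%:R ^+ j * N%:R * 2 * (d * N%:R) :> R.
      by rewrite ler_wpM2l// !mulr_ge0// exprn_ge0.
    by lra.
  have -> : N%:R ^+ j * (N%:R * (2 * y)) = \sum_(1 <= k < N.+1) N%:R ^+ j * (2 * y).
    by rewrite sumr_const_nat subn1 /= -mulr_natr; ring.
  rewrite /P /prime_pairs /weighted_pairs !mulr_sumr -big_split/=.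
  rewrite ler_sum_nat// => k /andP[k0 kN].
  have kj : k%:R ^+ j <= N%:R ^+ j :> R by rewrite lerXn2r ?nnegrE// ler_nat.
  have kj0 : 0 <= k%:R ^+ j :> R by rewrite exprn_ge0.
  apply: (@le_trans _ _ (k%:R ^+ j * (\sum_(1 <= a < k) u a * u (k - a)%N
      + lg N ^+ 2 * (2 * y)))); last first.
    rewrite mulrDr lerD2l mulrCA ler_wpM2l ?exprn_ge0// ler_wpM2r// mulr_ge0//.
  rewrite [leLHS](_ : _ = k%:R ^+ j * ((1 - ep) ^+ 2 * lg N ^+ 2 *
      \sum_(1 <= a < k) (odd_prime a && odd_prime (k - a))%:R)); last by ring.
  rewrite ler_wpM2l//.
  have cnt : \sum_(1 <= a < k) ((a%:R < y)%R%:R + ((k - a)%N%:R < y)%R%:R) <= 2 * y.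
    rewrite big_split/= [X in _ + X]big_nat_rev/=.
    have -> : \sum_(1 <= i < k) ((k - (1 + k - i.+1))%N%:R < y)%R%:R
        = \sum_(1 <= i < k) (i%:R < y)%R%:R :> R.
      by apply: eq_big_nat => i /andP[i0 ik]; congr ((_%:R < y)%R%:R); move: i0 ik; clear; lia.
    by have := count_lt k y0; lra.
  apply: le_trans (_ : \sum_(1 <= a < k) (u a * u (k - a)%N +
     lg N ^+ 2 * ((a%:R < y)%R%:R + ((k - a)%N%:R < y)%R%:R)) <= _); last first.
    by rewrite big_split/= -mulr_sumr lerD2l ler_wpM2l// exprn_ge0.
  rewrite mulr_sumr ler_sum_nat// => a /andP[a0 ak].
  have L20 : 0 <= lg N ^+ 2 by rewrite exprn_ge0.
  have uu : 0 <= u a * u (k - a)%N by rewrite mulr_ge0 ?odd_prime_ln_ge0.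
  case oo: (odd_prime a && odd_prime (k - a)); last first.
    by rewrite mulr0 addr_ge0// mulr_ge0// addr_ge0.
  have e2 : (1 - ep) ^+ 2 * lg N ^+ 2 <= lg N ^+ 2.
    rewrite -[leRHS]mul1r ler_wpM2r//.
    by rewrite expr2; nra.
  rewrite mulr1; have [ya|ya] := ltP (a%:R) y.
    by rewrite (le_trans e2)// ler_wpDl// mulrDr mulr1 lerDl mulr_ge0.
  have [yb|yb] := ltP ((k - a)%:R) y.
    by rewrite (le_trans e2)// ler_wpDl// add0r mulr1.
  rewrite addr0 mulr0 addr0 -exprMn expr2.
  have /andP[oa ob] := oo; rewrite /odd_prime_ln oa ob.
  have g m : y <= m%:R -> (1 - ep) * lg N <= lg m.
    move=> ym; rewrite -[leLHS]expRK ler_ln ?posrE ?expR_gt0//.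
    by rewrite (lt_le_trans _ ym)// expR_gt0.
  by rewrite ler_pM ?g// mulr_ge0//; lra.
move: h1; rewrite !ler_norml => /andP[h4 h5].
set Q := lg N ^+ 2 * P in lo up *.
have eX : 0 <= (e' - e) * X by rewrite mulr_ge0// subr_ge0.
have dX : d * X = e * X / 6 by rewrite /d; ring.
have eX0 : 0 <= e * X by rewrite mulr_ge0// ltW.
apply/andP; split; first by lra.
suff : Q <= (c + e) * X by lra.
have q1 : (1 - 2 * ep) * Q <= (c + e / 2) * X.
  have Q0 : 0 <= Q by rewrite mulr_ge0 ?exprn_ge0// sumr_ge0// => k _;
    rewrite mulr_ge0 ?exprn_ge0// sumr_ge0.
  have : 0 <= ep ^+ 2 * Q by rewrite mulr_ge0// exprn_ge0// ltW.
  by lra.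
have q2 : (c + e / 2) * X <= (1 - 2 * ep) * ((c + e) * X).
  rewrite mulrA ler_wpM2r//.
  have : ep * (c + e) <= e / 4 by rewrite -epc ler_wpM2l ?(ltW ep0)//; lra.
  by lra.
have z : 0 < 1 - 2 * ep by lra.
by rewrite -(ler_pM2l z) (le_trans q1).
Qed.

End PrimePairs.

(** * Moments of Goldbach partitions *)

Definition goldbach_moment {R : realType} (j n : nat) : R :=
  \sum_(pq <- goldbach_space n) (pq.1 + pq.2)%:R ^+ j.

Definition pair_term {R : realType} (j N a b : nat) : R :=
  if [&& odd_prime a, odd_prime b & (a + b <= N)%N] then (a + b)%:R ^+ j else 0.

(** The factor 2 passes from unordered to ordered pairs, so the limit is the constant of
    [prime_pairs]. *)
Definition normalized_moment {R : realType} (j n : nat) : R :=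
  2 * ln (2 * n)%:R ^+ 2 * goldbach_moment j n / (2 * n)%:R ^+ (j + 2).

Lemma odd_prime_gt2 p : odd_prime p -> (2 < p)%N.
Proof.
move=> /andP[pp op]; rewrite ltn_neqAle prime_gt1// andbT.
by apply: contraTneq op => <-.
Qed.

Section GoldbachMoments.
Variable R : realType.
Local Notation lg n := (@ln R n%:R).
Local Notation moment := (@goldbach_moment R).
Local Notation term := (@pair_term R).
Local Notation X := (@normalized_moment R).

Lemma prime_pairsE j N :
  prime_pairs j N = \sum_(0 <= a < N.+1) \sum_(0 <= b < N.+1) term j N a b.
Proof.
transitivity (\sum_(1 <= k < N.+1) \sum_(1 <= a < k)
    (a + (k - a))%:R ^+ j * (odd_prime a && odd_prime (k - a))%:R : R).
  apply: eq_bigr => k _; rewrite mulr_sumr; apply: eq_big_nat => a /andP[_ ak].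
  by rewrite subnKC// ltnW.
rewrite (sum_pairs N (fun a b => (a + b)%:R ^+ j * (odd_prime a && odd_prime b)%:R : R)).
rewrite [RHS]big_ltn//= [Y in Y + _]big1_seq ?add0r; last first.
  by move=> b _; rewrite /pair_term.
apply: eq_big_nat => a /andP[a0 aN].
rewrite [RHS]big_ltn//= {1}/pair_term andbF add0r.
rewrite (big_nat_widen 1 _ N.+1) ?ltnS ?leq_subr// big_mkcond.
apply: eq_big_nat => b /andP[b0 bN]; rewrite /pair_term andTb ltnS.
rewrite leq_subRL// andbA; case: (odd_prime a && odd_prime b); rewrite /= ?mulr1 ?mulr0 ?if_same//.
Qed.

Lemma goldbach_momentE j n : moment j n = \sum_(0 <= a < (2 * n).+1)
  \sum_(0 <= b < (2 * n).+1) (if (a <= b)%N then term j (2 * n) a b else 0).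
Proof.
rewrite /goldbach_moment /goldbach_space big_filter big_mkcond big_allpairs.
rewrite /index_iota subn0; apply: eq_bigr => a _; apply: eq_bigr => b _ /=.
rewrite /pair_term; case oa: (odd_prime a); last by rewrite if_same.
case ob: (odd_prime b); last by rewrite if_same.
have := odd_prime_gt2 oa; have := odd_prime_gt2 ob => b2 a2.
rewrite (_ : (4 < a + b)%N) /=; last by lia.
by case: leqP; rewrite ?andbF//= => ab.
Qed.

(** Exchanging the primes in one of the two copies gives the pairs with [b <= a]; together they
    cover all ordered pairs, with the diagonal counted twice. *)
Lemma goldbach_moment_double j n : 2 * moment j n = prime_pairs j (2 * n)
  + \sum_(0 <= a < (2 * n).+1) term j (2 * n) a a.
Proof.
rewrite mulr_natl mulr2n {2}goldbach_momentE exchange_big/= goldbach_momentE.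
rewrite prime_pairsE -!big_split/=; apply: eq_big_nat => a aN.
rewrite -big_split/=.
have -> : term j (2 * n) a a = \sum_(0 <= b < (2 * n).+1)
    (if b == a then term j (2 * n) a b else 0).
  by rewrite -big_mkcond/= big_nat1_eq aN.
rewrite -big_split/=; apply: eq_bigr => b _.
have -> : term j (2 * n) b a = term j (2 * n) a b.
  by rewrite /pair_term addnC andbCA.
by case: (ltngtP a b) => _; rewrite ?addr0 ?add0r.
Qed.

Lemma diag_bounds j N :
  0 <= \sum_(0 <= a < N.+1) term j N a a <= N.+1%:R * N%:R ^+ j.
Proof.
have t0 a : 0 <= term j N a a <= N%:R ^+ j.
  rewrite /pair_term; case: ifP => [/and3P[_ _ aN]|_]; rewrite ?lexx exprn_ge0//=.
  by rewrite lerXn2r ?nnegrE// ler_nat.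
rewrite sumr_ge0/=; last by move=> a _; case/andP: (t0 a).
rewrite (le_trans (ler_sum _ (G := fun=> N%:R ^+ j) _))//.
  by move=> a _; case/andP: (t0 a).
by rewrite sumr_const_nat subn0 mulr_natl.
Qed.

(** The diagonal adds at most [(N + 1) N^j ln^2 N], which is [o(N^(j + 2))]. *)
Lemma goldbach_moment_cvg j c :
  asymp (fun N => lg N ^+ 2 * prime_pairs j N) (j + 2) c ->
  X j @ \oo --> c.
Proof.
move=> h; rewrite /normalized_moment; apply/cvgrPdist_le => /= e e0.
have e2 : 0 < e / 2 by rewrite divr_gt0.
have e4 : 0 < e / 4 by rewrite divr_gt0.
have [n1 h1] := h _ e2; have [n2 h2] := @ln_sqr_small R 1 _ ltr01 e4.
exists (maxn n1 n2) => // n /=; rewrite geq_max => /andP[nn1 nn2].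
set N := (2 * n)%N; have nN : (n <= N)%N by rewrite leq_pmull.
have {}h1 := h1 N (leq_trans nn1 nN); have [N0 [l1 h3]] := h2 N (leq_trans nn2 nN).
move: h3; rewrite mul1r lnK ?posrE ?ltr0n// => h3.
have X0 : 0 < N%:R ^+ (j + 2) :> R by rewrite exprn_gt0// ltr0n.
rewrite -(ler_pM2r X0) -[Y in _ * Y <= _](gtr0_norm X0) -normrM mulrBl divfK ?gt_eqF//.
rewrite distrC -mulrA mulrCA goldbach_moment_double -/N mulrDr.
have /andP[D0 D1] := diag_bounds j N; set D := \sum_(_ <= _ < _) _ in D0 D1 *.
have : 0 <= lg N ^+ 2 * D <= e / 2 * N%:R ^+ (j + 2).
  rewrite mulr_ge0 ?exprn_ge0 ?lg_ge0//=.
  apply: (@le_trans _ _ (e / 4 * N%:R * (2 * N%:R * N%:R ^+ j))).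
    rewrite ler_pM ?exprn_ge0 ?lg_ge0//; apply: (le_trans D1).
    by rewrite ler_wpM2r ?exprn_ge0// -natrM ler_nat; lia.
  by rewrite exprD le_eqVlt; apply/orP; left; apply/eqP; field.
move: h1; rewrite !ler_norml; set A := lg N ^+ 2 * prime_pairs j N.
by set Y := N%:R ^+ _; move=> /andP[? ?] /andP[? ?]; lra.
Qed.

Lemma Gn_half n pq : pq \in goldbach_space n ->
  (Gn pq)%:R = (pq.1 + pq.2)%:R / 2 :> R.
Proof.
rewrite mem_filter => /andP[/and5P[/andP[_ o1] /andP[_ o2] _ _ _] _].
have : (2 %| pq.1 + pq.2)%N by rewrite dvdn2 oddD o1 o2.
by move=> d; rewrite -{1}(divnK d) natrM mulfK.
Qed.

Lemma size_goldbach n : (size (goldbach_space n))%:R = moment 0 n.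
Proof.
rewrite /goldbach_moment (eq_bigr (fun=> 1)) => [|pq _]; last by rewrite expr0.
by rewrite big_const_seq count_predT iter_addr_0.
Qed.

Lemma expect_GE n : expect_G R n = moment 1 n / 2 / moment 0 n.
Proof.
rewrite /expect_G size_goldbach; congr (_ / _).
rewrite /goldbach_moment mulr_suml big_seq [RHS]big_seq.
by apply: eq_bigr => pq /Gn_half ->; rewrite expr1.
Qed.

Lemma var_GE n : var_G R n = moment 2 n / 4 / moment 0 n - (expect_G R n) ^+ 2.
Proof.
have s2 : \sum_(pq <- goldbach_space n) (Gn pq)%:R ^+ 2 = moment 2 n / 4.
  rewrite /goldbach_moment mulr_suml big_seq [RHS]big_seq.
  by apply: eq_bigr => pq /Gn_half ->; field.
have s1 : \sum_(pq <- goldbach_space n) (Gn pq)%:R = moment 1 n / 2.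
  rewrite /goldbach_moment mulr_suml big_seq [RHS]big_seq.
  by apply: eq_bigr => pq /Gn_half ->; rewrite expr1.
rewrite /var_G size_goldbach; set E := expect_G R n.
have -> : \sum_(pq <- goldbach_space n) ((Gn pq)%:R - E) ^+ 2
   = moment 2 n / 4 - 2 * E * (moment 1 n / 2) + E ^+ 2 * moment 0 n.
  rewrite -s2 -s1 -size_goldbach mulr_natr mulr_sumr -sumrB.
  have -> : E ^+ 2 *+ size (goldbach_space n) = \sum_(pq <- goldbach_space n) E ^+ 2.
    by rewrite big_const_seq count_predT iter_addr_0.
  by rewrite -big_split/=; apply: eq_bigr => pq _; ring.
(* When there is no partition, division by zero yields 0 and both sides vanish. *)
rewrite /E expect_GE; have [->|m0] := eqVneq (moment 0 n) 0.
  by rewrite invr0 !mulr0 expr0n subr0.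
by field.
Qed.

Lemma normalized_moment_ratio j n : (0 < j)%N ->
  X j n / X 0 n = moment j n / ((2 * n)%:R ^+ j * moment 0 n).
Proof.
case: n => [|n] j0.
  (* At [n = 0] the right side vanishes because [0 ^+ j = 0] for [j > 0] and the inverse of 0 is
     0. *)
  rewrite /normalized_moment muln0 mulr0n (ln0 (lexx _)) (expr0n _ 2)/= mulr0 !mul0r.
  by rewrite expr0n (gtn_eqF j0) mul0r invr0 mulr0.
have [m0|m0] := eqVneq (moment 0 n.+1) 0.
  by rewrite /normalized_moment m0 !mulr0 mul0r invr0 !mulr0.
rewrite /normalized_moment exprD.
have N0 : (2 * n.+1)%:R != 0 :> R by rewrite pnatr_eq0.
have L0 : lg (2 * n.+1) != 0 by rewrite gt_eqF// ln_gt0// ltr1n; lia.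
have P0 : (2 * n.+1)%:R ^+ j != 0 :> R by rewrite expf_neq0.
have key (N L P a b : R) : N != 0 -> L != 0 -> P != 0 -> b != 0 ->
    2 * L ^+ 2 * a / (P * N ^+ 2) / (2 * L ^+ 2 * b / N ^+ 2) = a / (P * b).
  by move=> *; field; apply/and4P.
exact: key.
Qed.

Lemma normalized_moment0_cvg : X 0 @ \oo --> (1 / 2 : R).
Proof.
apply: goldbach_moment_cvg; apply: prime_pairs_asymp; first by lra.
exact: weighted_pairs0_asymp.
Qed.

Lemma normalized_moment1_cvg : X 1 @ \oo --> (1 / 3 : R).
Proof.
apply: goldbach_moment_cvg; apply: prime_pairs_asymp; first by lra.
exact: weighted_pairs1_asymp.
Qed.

Lemma normalized_moment2_cvg : X 2 @ \oo --> (1 / 4 : R).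
Proof.
apply: goldbach_moment_cvg; apply: prime_pairs_asymp; first by lra.
exact: weighted_pairs2_asymp.
Qed.

Lemma expect_G_cvg : (fun n => expect_G R n / n%:R) @ \oo --> (2 / 3 : R).
Proof.
have -> : (fun n => expect_G R n / n%:R) = (fun n => X 1 n / X 0 n).
  apply/funext => n; rewrite expect_GE normalized_moment_ratio// expr1 natrM !invfM.
  by ring.
rewrite (_ : 2 / 3 = (1 / 3) / (1 / 2)); last by field.
apply: cvgM; first exact: normalized_moment1_cvg.
by apply: cvgV; [rewrite gt_eqF//; lra|exact: normalized_moment0_cvg].
Qed.

Lemma var_G_cvg : (fun n => var_G R n / n%:R ^+ 2) @ \oo --> (1 / 18 : R).
Proof.
have -> : (fun n => var_G R n / n%:R ^+ 2)
  = (fun n => X 2 n / X 0 n - (X 1 n / X 0 n) * (X 1 n / X 0 n)).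
  apply/funext => n; rewrite var_GE expect_GE !normalized_moment_ratio// expr1 natrM exprMn !invfM.
  by set i := n%:R^-1; set m := (moment 0 n)^-1; field.
rewrite (_ : 1 / 18 = (1 / 4) / (1 / 2) - ((1 / 3) / (1 / 2)) * ((1 / 3) / (1 / 2)));
  last by field.
have i0 : (fun n => (X 0 n)^-1) @ \oo --> ((1 / 2)^-1 : R).
  by apply: cvgV; [rewrite gt_eqF//; lra|exact: normalized_moment0_cvg].
have i1 : (fun n => X 1 n / X 0 n) @ \oo --> ((1 / 3) / (1 / 2) : R).
  by apply: cvgM; [exact: normalized_moment1_cvg|exact: i0].
apply: cvgB; last exact: cvgM.
by apply: cvgM; [exact: normalized_moment2_cvg|exact: i0].
Qed.

End GoldbachMoments.

(** * The maximum of two uniform variables *)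

Section MaxOfUniforms.
Variable R : realType.
Local Notation mu := (@lebesgue_measure R).

Lemma ge0_integral_joint_U (f : measurableTypeR R * measurableTypeR R -> R) :
  measurable_fun setT f -> (forall z, 0 <= f z) ->
  (\int[joint_U R]_z (f z)%:E =
   \int[mu]_(x in `[0%R, 1%R]) \int[mu]_(y in `[0%R, 1%R]) (f (x, y))%:E)%E.
Proof.
move=> mf f0.
have /measurable_EFinP mf' := mf.
have f0' z : (0 <= (EFin \o f) z)%E by rewrite lee_fin.
rewrite /joint_U (fubini_tonelli1 (EFin \o f))//.
rewrite /unif01 integral_uniform//; last 2 first.
  exact: measurable_fun_fubini_tonelli_F.
  by move=> x; apply: integral_ge0 => y _.
rewrite subr0 invr1 mul1e; apply: eq_integral => x _.
rewrite /fubini_F integral_uniform//; last exact: measurableT_comp.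
by rewrite subr0 invr1 mul1e.
Qed.

(** The joint law lives on the whole plane, where the maximum can be negative, so Tonelli does not
    apply directly. It is applied to the positive and negative parts, and the latter vanishes on the
    unit square. *)
Lemma integral_joint_U (f : measurableTypeR R * measurableTypeR R -> R) : measurable_fun setT f ->
  (forall x y, 0 <= x <= 1 -> 0 <= y <= 1 -> 0 <= f (x, y)) ->
  (\int[joint_U R]_z (f z)%:E =
   \int[mu]_(x in `[0%R, 1%R]) \int[mu]_(y in `[0%R, 1%R]) (f (x, y))%:E)%E.
Proof.
move=> mf f0.
pose g z := Num.max (f z) 0; pose h z := Num.max (- f z) 0.
have mg : measurable_fun setT g by apply: measurable_funrpos.
have mh : measurable_fun setT h by apply: measurable_funrneg.
have g0 z : 0 <= g z by rewrite /g le_max lexx orbT.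
have h0 z : 0 <= h z by rewrite /h le_max lexx orbT.
rewrite integralE.
have -> : (\int[joint_U R]_z ((fun z => (f z)%:E)^\+ z) = \int[joint_U R]_z (g z)%:E)%E.
  by apply: eq_integral => z _; rewrite funeposE /g EFin_max.
have -> : (\int[joint_U R]_z ((fun z => (f z)%:E)^\- z) = \int[joint_U R]_z (h z)%:E)%E.
  by apply: eq_integral => z _; rewrite funenegE /h EFin_max.
rewrite !ge0_integral_joint_U//.
rewrite [X in (_ - X)%E](_ : _ = 0%E) ?sube0.
  apply: eq_integral => x /[!inE] /=; rewrite in_itv/= => x01.
  apply: eq_integral => y /[!inE] /=; rewrite in_itv/= => y01.
  by rewrite /g max_l// f0.
apply: integral0_eq => x /=; rewrite in_itv/= => x01.
apply: integral0_eq => y /=; rewrite in_itv/= => y01.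
by rewrite /h max_r// oppr_le0 f0.
Qed.

Lemma integral_deriv_poly (P : {poly R}) (a b : R) : a <= b ->
  (\int[mu]_(x in `[a, b]) (P^`()).[x]%:E = (P.[b] - P.[a])%:E)%E.
Proof.
rewrite le_eqVlt => /predU1P[->|ab].
  by rewrite set_itv1 integral_set1 subrr.
rewrite (@continuous_FTC2 _ (horner P^`()) (horner P) a b)//.
- by apply: continuous_subspaceT; apply: continuous_horner.
- split.
  + by move=> x _; apply: derivable_horner.
  + exact/cvg_at_right_filter/continuous_horner.
  + exact/cvg_at_left_filter/continuous_horner.
- by move=> x _; rewrite derive.derivE.
Qed.

Lemma integral_max_split (p : R -> R) (x : R) : 0 <= x <= 1 ->
  continuous p -> (forall y, 0 <= y <= 1 -> 0 <= p y) ->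
  (\int[mu]_(y in `[0%R, 1%R]) (p (Num.max x y))%:E =
   (x * p x)%:E + \int[mu]_(y in `[x, 1%R]) (p y)%:E)%E.
Proof.
move=> /andP[x0 x1] cp p0.
have mp : measurable_fun setT p by apply: continuous_measurable_fun.
have mpm : measurable_fun setT (fun y => (p (Num.max x y))%:E).
  apply/measurable_EFinP; apply: measurableT_comp => //.
  exact: (measurable_maxr (measurable_cst x) (@measurable_id _ _ setT)).
rewrite (@itv_bndbnd_setU _ _ _ (BRight x)) ?bnd_simp//.
rewrite ge0_integral_setU//=; last 3 first.
- exact: measurable_funTS.
- move=> y [] /=; rewrite in_itv/= => /andP[y0 y1]; rewrite lee_fin p0//.
    by rewrite le_max x0/= ge_max x1 (le_trans y1).
  by rewrite le_max x0/= ge_max x1.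
- apply/disj_set2P; rewrite -subset0 => y [] /=; rewrite !in_itv/=.
  by move=> /andP[_ yx] /andP[xy _]; have := lt_le_trans xy yx; rewrite ltxx.
congr (_ + _)%E.
  transitivity (\int[mu]_(y in `[0%R, x]) (p x)%:E)%E.
    apply: eq_integral => y /[!inE] /=; rewrite in_itv/= => /andP[_ yx].
    by rewrite max_l.
  rewrite integral_cst//= lebesgue_measure_itv/= lte_fin.
  case: ltP => x0'; first by rewrite sube0 -EFinM mulrC.
  by rewrite mule0 (_ : x = 0) ?mul0r//; apply/eqP; rewrite eq_le x0 x0'.
rewrite -integral_itv_obnd_cbnd; last by apply/measurable_EFinP; apply: measurable_funTS.
apply: eq_integral => y /[!inE] /=; rewrite in_itv/= => /andP[xy _].
by rewrite max_r// ltW.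
Qed.

Let horner_eqs := (mul1r, mulr1, @hornerM R, @hornerD R, @hornerN R, @hornerZ R,
  @hornerMn R, @hornerC R, @hornerXn R, @hornerX R).

Lemma measurable_max_prod :
  measurable_fun [set: measurableTypeR R * measurableTypeR R]
    (fun z => Num.max z.1 z.2 : R).
Proof. exact: (measurable_maxr measurable_fst measurable_snd). Qed.

Lemma mu_TE : mu_T R = 2 / 3.
Proof.
rewrite /mu_T integral_joint_U; [|exact: measurable_max_prod|]; last first.
  by move=> x y /andP[x0 _] _; rewrite le_max x0.
(* [P] is an antiderivative of the integrand on [y >= x], and [Q] of the inner integral
   [x * x + (1 - x^2) / 2]. *)
pose P : {poly R} := 2^-1 *: 'X^2.
pose Q : {poly R} := 2^-1 *: 'X + 6^-1 *: 'X^3.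
have dP x : (P^`()).[x] = x.
  by rewrite /P !poly.derivE !horner_eqs /=; field.
have dQ x : (Q^`()).[x] = (1 + x ^+ 2) / 2.
  by rewrite /Q !poly.derivE !horner_eqs /=; field.
have key (x : R) : 0 <= x <= 1 ->
    (\int[mu]_(y in `[0%R, 1%R]) (Num.max x y)%:E = (Q^`()).[x]%:E)%E.
  move=> x01; have /andP[_ x1] := x01.
  pose p (y : R) := y; rewrite (@integral_max_split p x x01); last 2 first.
  - by move=> y; exact: cvg_id.
  - by move=> y /andP[].
  transitivity ((x * p x)%:E + \int[mu]_(y in `[x, 1%R]) (P^`()).[y]%:E)%E.
    by congr (_ + _)%E; apply: eq_integral => y _; rewrite dP.
  rewrite integral_deriv_poly// -EFinD dQ /P !horner_eqs; congr EFin.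
  by rewrite /p; field.
transitivity (fine (\int[mu]_(x in `[0%R, 1%R]) (Q^`()).[x]%:E)%E).
  congr fine; apply: eq_integral => x /[!inE] /=; rewrite in_itv/= => x01.
  exact: key.
rewrite integral_deriv_poly//= /Q !horner_eqs.
by field.
Qed.

Lemma sigma2_TE : sigma2_T R = 1 / 18.
Proof.
rewrite /sigma2_T mu_TE; set m : R := 2 / 3.
rewrite (integral_joint_U (f := fun z => (Num.max z.1 z.2 - m) ^+ 2)); last 2 first.
- apply: measurable_funX; apply: measurable_funB; last exact: measurable_cst.
  exact: measurable_max_prod.
- by move=> x y _ _; rewrite sqr_ge0.
(* [P] is [(x - m)^3 / 3] up to a constant, and [Q] an antiderivative of
   [x (x - m)^2 + P(1) - P(x)]. *)
pose P : {poly R} := 3^-1 *: 'X^3 - m *: 'X^2 + m ^+ 2 *: 'X.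
pose Q : {poly R} := 6^-1 *: 'X^4 - (m / 3) *: 'X^3 + (3^-1 - m + m ^+ 2) *: 'X.
have dP x : (P^`()).[x] = (x - m) ^+ 2.
  by rewrite /P !poly.derivE !horner_eqs /=; field.
have dQ x : (Q^`()).[x] = 2 / 3 * x ^+ 3 - m * x ^+ 2 + (3^-1 - m + m ^+ 2).
  by rewrite /Q !poly.derivE !horner_eqs /=; field.
have key (x : R) : 0 <= x <= 1 ->
    (\int[mu]_(y in `[0%R, 1%R]) ((Num.max x y - m) ^+ 2)%:E = (Q^`()).[x]%:E)%E.
  move=> x01; have /andP[_ x1] := x01.
  pose p (y : R) := (y - m) ^+ 2; rewrite (@integral_max_split p x x01); last 2 first.
  - have -> : p = horner P^`() by apply/funext => y; rewrite dP.
    exact: continuous_horner.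
  - by move=> y _; rewrite sqr_ge0.
  transitivity ((x * p x)%:E + \int[mu]_(y in `[x, 1%R]) (P^`()).[y]%:E)%E.
    by congr (_ + _)%E; apply: eq_integral => y _; rewrite dP.
  rewrite integral_deriv_poly// -EFinD dQ /P !horner_eqs; congr EFin.
  by rewrite /p; field.
transitivity (fine (\int[mu]_(x in `[0%R, 1%R]) (Q^`()).[x]%:E)%E).
  congr fine; apply: eq_integral => x /[!inE] /=; rewrite in_itv/= => x01.
  exact: key.
rewrite integral_deriv_poly//= /Q !horner_eqs /m.
by field.
Qed.

End MaxOfUniforms.

Theorem theorem1 (R : realType) :
  ((fun n : nat => expect_G R n / n%:R) @ \oo --> mu_T R /\ mu_T R = 2 / 3) /\
  ((fun n : nat => var_G R n / (n%:R ^+ 2)) @ \oo --> sigma2_T R /\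
    sigma2_T R = 1 / 18).
Proof.
rewrite mu_TE sigma2_TE.
by split; split => //; [exact: expect_G_cvg|exact: var_G_cvg].
Qed.
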